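(* Let $\tau=\{\tau_1,\dots,\tau_n\}$ be an implicit-deadline sporadic task system on a heterogeneous platform of $m\ge 1$ processors with $z$ distinct speeds $1=\alpha_1<\alpha_2<\dots<\alpha_z=\alpha_{max}$, with $u_i\le\alpha_{max}$ for every task and $|\Phi_i|\le|\Psi_i|$ for each $1\le i<z$. Let $$x=\max\left(0,\ \frac{E^{*}-p_{min}}{R_{sum}-\overline{U}_{m-1}}\right).$$ If $U_{sum}\le R_{sum}$, then the response time of any task $\tau_i$ scheduled under NP-GEDF-H (non-preemptive GEDF-H) is at most $x+2\cdot p_i$.
   Context: Platform: there are $z\ge1$ kinds of processors; $\chi_i$ is the set of processors of kind $i$, $M_i=|\chi_i|\ge 1$, each of speed $\alpha_i$, with $1=\alpha_1<\alpha_2<\dots<\alpha_z=\alpha_{max}$; $m=\sum_i M_i$ and $R_{sum}=\sum_{i=1}^z\alpha_i M_i$. A job running for $t$ time units on a processor of speed $\alpha$ completes $\alpha t$ units of workload. Time is continuous and all parameters are positive rationals. Tasks: each sporadic task $\tau_i$ releases a sequence of jobs $\tau_{i,1},\tau_{i,2},\dots$; $\tau_{i,j}$ is released at $r_{i,j}$, consecutive releases are at least $p_i$ apart, each job requires at most $e_i$ units of workload, and its absolute deadline is $d_{i,j}=r_{i,j}+p_i$ (implicit deadlines). $u_i=e_i/p_i$, $U_{sum}=\sum_i u_i$, $p_{min}=\min_i p_i$. Tasks are independent, jobs of the same task must execute in sequence (a job cannot start before its predecessor completes), a job executes on at most one processor at a time and a processor executes at most one job at a time. A deadline miss does not alter later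 release times. If $\tau_{i,j}$ completes at time $t$, its response time is $\max(0,t-r_{i,j})$; a task's response time is the maximum (supremum) over its jobs. Notation: for $1\le i<z$, $\Phi_i=\{\tau_j:\alpha_i<u_j\}$; $\Psi_i=\bigcup_{j=i+1}^z\chi_j$. GEDF-H: jobs are prioritized by earliest absolute deadline, ties broken by lower task index. A job is enabled at $t$ if it has been released by $t$, is not completed, and its predecessor (if any) has completed. Enabled jobs are selected for execution in priority order, and processors are selected as follows when a job of $\tau_l$ is assigned: if $u_l\le1$, any available processor is used; if $\alpha_i<u_l\le\alpha_{i+1}$, an available processor of $\Psi_i$ is used if there is one; otherwise some job of a task with utilization at most $\alpha_i$ that is executing on a processor $M'\in\Psi_i$ is moved to an available processor and the job of $\tau_l$ is assigned to $M'$. The rule guarantees that whenever a job of $\tau_i$ executes on a processor of speed $\alpha'$, one has $u_i\le\alpha'$. In the non-preemptive version NP-GEDF-H, a job that has started execution cannot be preempted before it completes (even by higher-priority jobs); whenever a processor is available and enabled jobs are waiting, the highest-priority waiting one starts. $\overline{U}_{m-1}$ is the sum of the $m-1$ largest values $u_i$ among tasks of $\tau$ (of all of them if $n<m-1$). $E^{*}$ is the largest value of $\sum_{\tau_i\in\psi,\ \alpha_j\in\varphi}\left(e_i+u_i\, e_i\left(1-\frac{1}{\alpha_j}\right)\right)+e_k$, where $\psi$ ranges over sets of $m-1$ tasks of $\tau$ (all tasks if $n<m-1$), $\varphi$ is the collection of speeds of the $m-1$ fastest processors, each task of $\psi$ is paired with a distinct processor among these $m-1$, and $\tau_k$ is any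 task not in $\psi$ (the term $e_k$ is absent if there is none); the maximum is over $\psi$, the pairing and $\tau_k$. *)

(* Defs.v *)
From mathcomp Require Import all_boot all_order all_algebra.
From mathcomp Require Import all_classical all_reals all_analysis.
Set Implicit Arguments.
Unset Strict Implicit.
Unset Printing Implicit Defensive.
Import Order.TTheory GRing.Theory Num.Theory.
Local Open Scope classical_set_scope.
Local Open Scope ring_scope.

(* Uniform heterogeneous platform with [z.+1] kinds of processors, numbered
   from 0 in order of increasing speed, the slowest kind having speed 1. *)
Record platform (R : realType) (z : nat) := Platform {
  proc : finType;
  kind : proc -> 'I_z.+1;
  alpha : 'I_z.+1 -> R;
  alpha_rat : forall k, rational (alpha k);
  alpha_slowest : alpha ord0 = 1;
  alpha_incr : forall k k' : 'I_z.+1, (k < k')%N -> alpha k < alpha k';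
  kind_inhabited : forall k, (0 < #|[set q | kind q == k]%SET|)%N
}.

(* Implicit-deadline sporadic task system with [n.+1] tasks: worst-case
   workloads and minimum inter-release separations. *)
Record task_system (R : realType) (n : nat) := TaskSystem {
  cost : 'I_n.+1 -> R;
  period : 'I_n.+1 -> R;
  cost_rat : forall i, rational (cost i);
  period_rat : forall i, rational (period i);
  cost_gt0 : forall i, 0 < cost i;
  period_gt0 : forall i, 0 < period i
}.

(* One run of the task system: [release i j] and [work i j] are the release
   time and the actual workload of the job of index [j] of task [i], the first
   job having index 0. *)
Record job_sequence (R : realType) (n : nat) (ts : task_system R n) :=
  JobSequence {
  release : 'I_n.+1 -> nat -> R;
  work : 'I_n.+1 -> nat -> R;
  release_sep : forall i j, release i j + period ts i <= release i j.+1;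
  work_gt0 : forall i j, 0 < work i j;
  work_le_cost : forall i j, work i j <= cost ts i
}.

Section Bounds.
Context {R : realType} {z n : nat} (pf : platform R z) (ts : task_system R n).

Definition nprocs : nat := #|proc pf|.
Definition chi (k : 'I_z.+1) : {set proc pf} := [set q | kind q == k]%SET.
Definition speed (q : proc pf) : R := alpha pf (kind q).
Definition Rsum : R := \sum_(k < z.+1) alpha pf k * #|chi k|%:R.

Definition util (i : 'I_n.+1) : R := cost ts i / period ts i.
Definition Usum : R := \sum_(i < n.+1) util i.
Definition pmin : R := \big[Num.min/period ts ord0]_(i < n.+1) period ts i.

Definition Phi (k : 'I_z.+1) : {set 'I_n.+1} :=
  [set i | alpha pf k < util i]%SET.
Definition Psi (k : 'I_z.+1) : {set proc pf} :=
  (\bigcup_(k' : 'I_z.+1 | (k < k')%N) chi k')%SET.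

Definition Umax : R :=
  \sum_(u <- take nprocs.-1 (sort >=%R [seq util i | i <- enum 'I_n.+1])) u.

(* Speeds of all processors in nonincreasing order; the first [nprocs.-1]
   entries are those of the [nprocs.-1] fastest processors. *)
Definition speeds : seq R := sort >=%R [seq speed q | q <- enum (proc pf)].

(* [f] pairs the tasks of [psi] with distinct positions of [speeds] other than
   the last one; its values outside [psi] are irrelevant. *)
Definition pairing (psi : {set 'I_n.+1}) (f : {ffun 'I_n.+1 -> 'I_nprocs}) :
    bool :=
  [&& #|psi| == minn n.+1 nprocs.-1,
      [forall i in psi, (f i < nprocs.-1)%N] &
      [forall i in psi, forall j in psi, (f i == f j) ==> (i == j)]].

(* All summands are positive, so the default value 0 of the outer maximum is
   never selected, and that of the inner one only when [psi] contains every
   task. *)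
Definition Estar : R :=
  \big[Num.max/0]_(c : {set 'I_n.+1} * {ffun 'I_n.+1 -> 'I_nprocs}
                     | pairing c.1 c.2)
    (\sum_(i in c.1)
       (cost ts i + util i * cost ts i * (1 - (nth 1 speeds (c.2 i))^-1))
     + \big[Num.max/0]_(k | k \notin c.1) cost ts k).

Definition xbound : R := Num.max 0 ((Estar - pmin) / (Rsum - Umax)).

End Bounds.

Section Scheduling.
Context {R : realType} {z n : nat} (pf : platform R z) (ts : task_system R n).
Context (js : job_sequence ts).

Definition job : Type := ('I_n.+1 * nat)%type.
Definition assignment : Type := {ffun proc pf -> option job}.
Definition schedule : Type := R -> assignment.

Definition deadline (J : job) : R := release js J.1 J.2 + period ts J.1.

Definition higher_priority (J J' : job) : bool :=
  (deadline J < deadline J') ||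
  ((deadline J == deadline J') && (J.1 < J'.1)%N).

Definition running (A : assignment) (J : job) : bool :=
  [exists q, A q == Some J].

Section Progress.
Context (sched : schedule).

Definition rate (J : job) (t : R) : R :=
  \sum_(q : proc pf | sched t q == Some J) speed q.

Definition service (J : job) (t : R) : R :=
  (\int[lebesgue_measure]_(s in `[release js J.1 J.2, t]) rate J s)%R.

Definition completed (J : job) (t : R) : bool :=
  work js J.1 J.2 <= service J t.

Definition enabled (J : job) (t : R) : bool :=
  [&& release js J.1 J.2 <= t, ~~ completed J t &
      if J.2 is j.+1 then completed (J.1, j) t else true].

Definition waiting (t : R) (A : assignment) (J : job) : bool :=
  enabled J t && ~~ running A J.

(* [+oo] when the job never completes. *)
Definition completion_time (J : job) : \bar R :=
  ereal_inf [set t%:E | t in [set t | completed J t]].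

Definition job_response_time (J : job) : \bar R :=
  maxe 0%E (completion_time J - (release js J.1 J.2)%:E)%E.

Definition response_time (i : 'I_n.+1) : \bar R :=
  ereal_sup (range (fun j : nat => job_response_time (i, j))).

End Progress.

Definition assign (A : assignment) (q : proc pf) (J : job) : assignment :=
  [ffun q' => if q' == q then Some J else A q'].

(* [place D A J A'] : starting from assignment [A], the job [J] gets a processor
   of [D], possibly after a move, and [A'] results.  A job of a task with
   utilization at most [alpha k] displaced from [Psi k] goes to an available
   processor.  None is available in [Psi k], so it goes to a slower one; if no
   available one is fast enough for its own utilization, the selection rule
   applies to it in turn, outside [Psi k].  Without this iteration a displaced
   job could land on a processor slower than its utilization. *)
Inductive place (D : {set proc pf}) (A : assignment) (J : job) :
    assignment -> Prop :=
| place_slow q :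
    util ts J.1 <= 1 -> q \in D -> A q = None ->
    place D A J (assign A q J)
| place_fast (k k' : 'I_z.+1) q :
    k' = k.+1 :> nat -> alpha pf k < util ts J.1 <= alpha pf k' ->
    q \in D -> q \in Psi pf k -> A q = None ->
    place D A J (assign A q J)
| place_move (k k' : 'I_z.+1) q J' A' :
    k' = k.+1 :> nat -> alpha pf k < util ts J.1 <= alpha pf k' ->
    (forall q', q' \in Psi pf k -> A q' <> None) ->
    q \in D -> q \in Psi pf k -> A q = Some J' -> util ts J'.1 <= alpha pf k ->
    place (~: Psi pf k)%SET (assign A q J) J' A' ->
    place D A J A'.

Inductive dispatch (sched : schedule) (t : R) (A : assignment) :
    assignment -> Prop :=
| dispatch_done :
    (forall q, A q <> None) \/ (forall J, ~~ waiting sched t A J) ->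
    dispatch sched t A A
| dispatch_next J A' A'' :
    (exists q, A q = None) ->
    waiting sched t A J ->
    (forall J', waiting sched t A J' -> J' != J -> higher_priority J J') ->
    place [set: proc pf]%SET A J A' ->
    dispatch sched t A' A'' ->
    dispatch sched t A A''.

(* Processors are released only by jobs that complete: no preemption. *)
Definition vacate (sched : schedule) (t : R) (A : assignment) : assignment :=
  [ffun q => if A q is Some J then
               if completed sched J t then None else Some J
             else None].

(* [sched] is a right-continuous step function of time; at each instant [t] the
   assignment in force just before [t] is updated by the scheduler.  Away from
   releases and completions the update changes nothing. *)
Record np_gedf_h (sched : schedule) : Prop := NPGEDFH {
  only_enabled : forall t q J, sched t q = Some J -> enabled sched J t;
  one_processor : forall t q q' J,
    sched t q = Some J -> sched t q' = Some J -> q = q';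
  right_constant : forall t, exists2 eps : R, 0 < eps &
    forall s, t <= s < t + eps -> sched s = sched t;
  scheduler_step : forall t, exists (A : assignment) (eps : R),
    [/\ 0 < eps, (forall s, t - eps < s < t -> sched s = A) &
        dispatch sched t (vacate sched t A) (sched t)]
}.

End Scheduling.

Arguments job n : clear implicits.
Arguments assignment {R z} n pf.
Arguments schedule {R z} n pf.

(* Main.v *)
(* A job J is delayed only by jobs preceding it (earlier deadline, or equal
   deadline and lower task index) and by jobs that started before.  Going back
   from a time t at which J waits to the last quiet time s, when no preceding job
   waits and some processor executes none, all processors are busy with such jobs
   in between.  So the work pending at s, which belongs to fewer tasks than there
   are processors, decides how late J can be.  It is measured by the lag of a job,
   its remaining work plus its utilization times its lateness, which does not
   increase while a task executes without interruption.

   The total lag of tasks executing simultaneously is bounded by induction on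
   their number: of those that started last, take the one of lowest priority; just
   before its start it was waiting, so the delay bound limits the sum of its
   lateness and of the lags of the others.  Since a quiet time precedes the deadline
   of a late J by at least the minimal period, the two bounds follow from each other
   by induction on time.  Bounding each lag separately by the response time bound
   would lose the term [- pmin] of [xbound]. *)

Require Import Defs.
From mathcomp Require Import all_boot all_order all_algebra.
From mathcomp Require Import all_classical all_reals all_analysis.
From mathcomp Require Import ring lra zify.
Set Implicit Arguments.
Unset Strict Implicit.
Unset Printing Implicit Defensive.
Import Order.TTheory GRing.Theory Num.Theory.
Local Open Scope ring_scope.

(** * Real induction *)

(** Let [T] be the total lag of the tasks of [A], [U] their total utilization, [G] the constant
    [Gbound], and [y] the lateness of the lowest-priority task [i] among those that started last.
    The delay bound gives [T + (Rs - U) * y <= G], and the induction hypothesis for the other tasks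
    gives [T <= lag_bound (A :\ i) + cost ts i + util ts i * y]. Eliminating [y] leaves a recurrence
    in [A], which [total_cost A + total_util A * G / Rs] satisfies with slack
    [util ts i * total_cost A]. This slack is spent on the correction [- P * maxutil A] in
    [lag_bound], and the correction in turn lets the delay bound close although the numerator of
    [xbound] is reduced by [pmin]. A schedule is a step function only locally, on each side of every
    instant, and no sequence of events is given. Statements over time are therefore proved by real
    induction, and quiet times are reached through suprema that need not be attained, hence the
    error terms [eta]. *)

Section RealInduction.
Context {R : realType}.
Implicit Types (a b t s : R) (Q : R -> Prop).

(** At the supremum of the times up to which [Q] holds throughout, the last hypothesis gives [Q],
    and the third one carries it further unless [b] is reached. It takes the place of an induction
    over scheduling events. *)
Lemma real_induction a b Q : a <= b -> Q a ->
  (forall t, a <= t < b -> Q t ->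
     exists2 eps : R, 0 < eps & forall s, t < s < t + eps -> Q s) ->
  (forall t, a < t <= b -> (forall s, a <= s < t -> Q s) -> Q t) ->
  Q b.
Proof.
move=> ab Qa Qr Ql; apply: contrapT => nQb.
pose Z := [set t | a <= t <= b /\ forall s, a <= s <= t -> Q s]%classic.
have Za : Z a.
  by split=> [|s]; rewrite ?lexx // => /andP[as_ sa]; rewrite (@le_anti _ _ s a) ?as_ ?sa.
have ubZ : ubound Z b by move=> t [/andP[]].
have supZ : has_sup Z by split; [exists a | exists b].
set c := sup Z.
have ac : a <= c by apply: ub_le_sup => //; exists b.
have cb : c <= b by apply: ge_sup => //; exists a.
have Qlt s : a <= s < c -> Q s.
  case/andP=> as_ sc; have [|t [_ Zt] st] := sup_adherent (_ : 0 < c - s) supZ.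
    by rewrite subr_gt0.
  by apply: Zt; rewrite as_ /=; move: st; rewrite -/c opprB addrC subrK => /ltW.
have Qc : Q c.
  have [<-//|ac'] := eqVneq a c.
  by apply: Ql => //; rewrite lt_neqAle ac' ac cb.
have [cb'|cb'] := eqVneq c b; first by rewrite cb' in Qc.
have ltcb : c < b by rewrite lt_neqAle cb' cb.
have [|eps eps0 Qe] := Qr c _ Qc; first by rewrite ac ltcb.
pose d := Num.min b (c + eps / 2).
have cd : c < d by rewrite /d lt_min ltcb /= ltrDl divr_gt0.
have Zd : Z d.
  split; first by rewrite (le_trans ac (ltW cd)) /d ge_min lexx.
  move=> s /andP[as_ sd]; have [sc|cs|->//] := ltgtP s c; first by apply: Qlt; rewrite as_.
  apply: Qe; rewrite cs /=; apply: le_lt_trans sd _.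
  by rewrite /d gt_min; apply/orP; right; rewrite ltrD2l; lra.
have : d <= c by apply: ub_le_sup => //; exists b.
by rewrite leNgt cd.
Qed.

Lemma real_induction_down a b Q : a <= b -> Q b ->
  (forall t, a < t <= b -> Q t ->
     exists2 eps : R, 0 < eps & forall s, t - eps < s < t -> Q s) ->
  (forall t, a <= t < b -> (forall s, t < s <= b -> Q s) -> Q t) ->
  Q a.
Proof.
move=> ab Qb Ql Qr; rewrite -[a]opprK.
apply: (@real_induction (- b) (- a) (fun t => Q (- t))); rewrite ?opprK ?lerN2 //.
- move=> t /andP[bt ta] /Ql[|eps eps0 Qe]; first by apply/andP; split; lra.
  by exists eps => // s /andP[ts se]; apply: Qe; apply/andP; split; lra.
- move=> t /andP[bt ta] Qs; apply: Qr; first by apply/andP; split; lra.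
  move=> s /andP[ts sb]; rewrite -[s]opprK; apply: Qs.
  by apply/andP; split; lra.
Qed.

Lemma le_of_locally_nondecreasing a b (f : R -> R) : a <= b ->
  (forall t, a <= t < b ->
     exists2 eps : R, 0 < eps & forall s, t < s < t + eps -> f t <= f s) ->
  (forall t, a < t <= b ->
     exists2 eps : R, 0 < eps & forall s, t - eps < s < t -> f s <= f t) ->
  f a <= f b.
Proof.
move=> ab fr fl; apply: (@real_induction a b (fun t => f a <= f t)) => //.
- move=> t tab fat; have [eps eps0 fe] := fr t tab.
  by exists eps => // s /fe; apply: le_trans.
- move=> t tab IH; have [eps eps0 fe] := fl t tab.
  case/andP: tab => at_ tb; pose s := Num.max a (t - eps / 2).
  have st : s < t by rewrite /s gt_max at_ /=; lra.
  apply: (le_trans (IH s _)); first by rewrite st /s le_max lexx.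
  by apply: fe; rewrite st andbT /s lt_max; apply/orP; right; lra.
Qed.

Lemma le_of_lt_add_eps (x y K : R) : 0 <= K ->
  (forall eta : R, 0 < eta -> x <= y + K * eta) -> x <= y.
Proof.
move=> K0 H; rewrite leNgt; apply/negP => yx.
have K1 : 0 < K + 1 by lra.
have eta0 : 0 < (x - y) / (K + 1) by rewrite divr_gt0 // subr_gt0.
have := H _ eta0; rewrite mulrA; apply/negP; rewrite -ltNge -ltrBDl.
by rewrite ltr_pdivrMr // [X in _ < X]mulrC ltr_pM2r ?subr_gt0//; lra.
Qed.

End RealInduction.

(** * Bounds on Estar and Umax *)

Lemma exists_superset_card (T : finType) (B : {set T}) k :
  (#|B| <= k <= #|T|)%N -> exists2 C : {set T}, B \subset C & #|C| = k.
Proof.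
elim: k => [|k IH] /andP[Bk kT].
  by exists B => //; apply/eqP; rewrite -leqn0.
have [Bk'|kB] := leqP #|B| k; last by exists B => //; apply/eqP; rewrite eqn_leq Bk.
have [|C BC Ck] := IH; first by rewrite Bk' ltnW.
have [y yC] : exists y, y \in ~: C.
  by apply/card_gt0P; rewrite cardsCs finset.setCK Ck subn_gt0.
exists (y |: C); first exact: fintype.subset_trans BC (finset.subsetUr _ _).
by rewrite cardsU1 Ck; rewrite inE in yC; rewrite yC.
Qed.

Section PlatformBounds.
Context {R : realType} {z n : nat} (pf : platform R z) (ts : task_system R n).

Lemma alpha_ge1 k : 1 <= alpha pf k.
Proof.
rewrite -(alpha_slowest pf); have [->|k0] := eqVneq k ord0 => //.
by apply/ltW/alpha_incr; rewrite lt0n.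
Qed.

Lemma alpha_mono (k k' : 'I_z.+1) : (k <= k')%N -> alpha pf k <= alpha pf k'.
Proof.
rewrite leq_eqVlt => /orP[/eqP/val_inj->//|].
by move=> kk; apply/ltW/alpha_incr.
Qed.

Lemma speed_ge1 q : 1 <= speed (pf := pf) q. Proof. exact: alpha_ge1. Qed.

Lemma speed_ge0 q : 0 <= speed (pf := pf) q.
Proof. exact: le_trans ler01 (speed_ge1 q). Qed.

Lemma RsumE : Rsum pf = \sum_q speed (pf := pf) q.
Proof.
rewrite (partition_big (kind (p := pf)) xpredT) //=; apply: eq_bigr => k _.
rewrite (eq_bigr (fun=> alpha pf k)); last by move=> q /eqP <-.
by rewrite sumr_const mulr_natr; congr (_ *+ _); apply: eq_card => q; rewrite inE.
Qed.

Lemma in_Psi k q : (q \in Psi pf k) = (k < kind q)%N.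
Proof.
apply/bigcupP/idP => [[k' kk']|kq]; first by rewrite inE => /eqP ->.
by exists (kind q); rewrite ?inE.
Qed.

Lemma nprocs_gt0 : (0 < nprocs pf)%N.
Proof.
have := kind_inhabited pf ord0; rewrite card_gt0 => /set0Pn[q _].
by apply/card_gt0P; exists q.
Qed.

Lemma alpha_le_Rsum k : alpha pf k <= Rsum pf.
Proof.
rewrite /Rsum (bigD1 k) //= ler_wpDr //.
  apply: sumr_ge0 => k' _; rewrite mulr_ge0 //.
  exact: le_trans ler01 (alpha_ge1 k').
rewrite ler_peMr ?(le_trans ler01) ?alpha_ge1 // ler1n.
exact: kind_inhabited.
Qed.

Lemma Rsum_ge1 : 1 <= Rsum pf.
Proof. exact: le_trans (alpha_ge1 ord0) (alpha_le_Rsum _). Qed.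

Lemma util_gt0 i : 0 < util ts i.
Proof. by rewrite divr_gt0 ?cost_gt0 ?period_gt0. Qed.

Lemma costE i : cost ts i = util ts i * period ts i.
Proof. by rewrite divfK // gt_eqF ?period_gt0. Qed.

Lemma pmin_le i : pmin ts <= period ts i.
Proof. by rewrite /pmin; apply: bigmin_le_cond. Qed.

Lemma pmin_gt0 : 0 < pmin ts.
Proof.
by apply/bigmin_gtP; split=> [|i _]; exact: period_gt0.
Qed.

Lemma util_pmin_le_cost i : util ts i * pmin ts <= cost ts i.
Proof. by rewrite costE ler_pM2l ?util_gt0 ?pmin_le. Qed.

(** Speeds are at least 1, so each summand of [Estar] is at least the cost of its task, whatever the
    pairing. A small [B] is extended to an admissible [psi]; a [B] with one task per processor is
    split into [psi] and one task for the inner maximum. *)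
Lemma Estar_ge (B : {set 'I_n.+1}) : (#|B| <= nprocs pf)%N ->
  \sum_(i in B) cost ts i <= Estar pf ts.
Proof.
have nth_speeds_ge1 j : 1 <= nth 1 (speeds pf) j.
  have [jm|jm] := ltnP j (size (speeds pf)); last by rewrite nth_default.
  have := mem_nth 1 jm; rewrite mem_sort => /mapP[q _ ->].
  exact: speed_ge1.
have pair_ge (psi : {set 'I_n.+1}) : #|psi| = minn n.+1 (nprocs pf).-1 ->
  \sum_(i in psi) cost ts i + \big[Num.max/0]_(k | k \notin psi) cost ts k
    <= Estar pf ts.
  move=> psiE; pose f := [ffun i => insubd (Ordinal nprocs_gt0) (index i (enum psi))].
  have fE i : i \in psi -> (f i < (nprocs pf).-1)%N /\ f i = index i (enum psi) :> nat.
    move=> ipsi; have im : (index i (enum psi) < (nprocs pf).-1)%N.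
      apply: leq_trans (_ : (#|psi| <= _)%N); last by rewrite psiE geq_minr.
      by rewrite cardE index_mem mem_enum.
    by rewrite ffunE val_insubd (leq_trans im (leq_pred _)).
  have pf_ok : pairing psi f.
    apply/and3P; split; first exact/eqP.
      by apply/forallP => i; apply/implyP => /fE[].
    apply/forallP => i; apply/implyP => ipsi; apply/forallP => j; apply/implyP => jpsi.
    apply/implyP => /eqP fij; apply/eqP.
    have := congr1 val fij; rewrite /= (fE i ipsi).2 (fE j jpsi).2 => /(congr1 (nth i (enum psi))).
    by rewrite !nth_index ?mem_enum.
  pose F (c : {set 'I_n.+1} * {ffun 'I_n.+1 -> 'I_(nprocs pf)}) := \sum_(i in c.1)
       (cost ts i + util ts i * cost ts i * (1 - (nth 1 (speeds pf) (c.2 i))^-1))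
     + \big[Num.max/0]_(k | k \notin c.1) cost ts k.
  apply: le_trans (_ : F (psi, f) <= _).
    rewrite /F /= lerD2r; apply: ler_sum => i _; rewrite lerDl mulr_ge0 //.
      by rewrite mulr_ge0 // ltW ?util_gt0 ?cost_gt0.
    by rewrite subr_ge0 invf_le1 // (lt_le_trans ltr01).
  exact: (le_bigmax_cond 0 F (pf_ok : (fun c => pairing c.1 c.2) (psi, f))).
have bmax_ge0 (psi : {set 'I_n.+1}) : 0 <= \big[Num.max/0]_(k | k \notin psi) cost ts k.
  by elim/big_rec: _ => // i x _ x0; rewrite le_max x0 orbT.
move=> Bm; have [small|big] := leqP #|B| (minn n.+1 (nprocs pf).-1).
  have [|psi Bpsi psiE] := @exists_superset_card _ B (minn n.+1 (nprocs pf).-1).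
    by rewrite small card_ord geq_minl.
  apply: le_trans (pair_ge psi psiE); rewrite ler_wpDr //.
  rewrite [leRHS](big_setID B) /= (finset.setIidPr Bpsi) ler_wpDr //.
  by apply: sumr_ge0 => i _; rewrite ltW ?cost_gt0.
have Bn : (#|B| <= n.+1)%N by apply: leq_trans (max_card _) _; rewrite card_ord.
have Bmax : #|B| = (nprocs pf).-1.+1.
  move: big Bm Bn; rewrite -(prednK nprocs_gt0) /=; lia.
have [l lB] : exists l, l \in B by apply/card_gt0P; rewrite Bmax.
have BlE : #|(B :\ l)%SET| = minn n.+1 (nprocs pf).-1.
  have := cardsD1 l B; rewrite lB Bmax; lia.
apply: le_trans (pair_ge _ BlE).
by rewrite (big_setD1 l) //= addrC lerD2l; apply: le_bigmax_cond; rewrite !inE eqxx.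
Qed.

Let byutil := sort (relpre (util ts) >=%R) (enum 'I_n.+1).
Let top := take (nprocs pf).-1 byutil.

Lemma UmaxE : Umax pf ts = \sum_(i in [set i in top]%SET) util ts i.
Proof.
rewrite /Umax sort_map -map_take big_map -/byutil -/top.
rewrite [RHS](eq_bigl (mem top)); last by move=> i; rewrite inE.
by rewrite big_uniq ?take_uniq ?sort_uniq ?enum_uniq.
Qed.

Lemma card_top_le : (#|[set i in top]%SET| <= (nprocs pf).-1)%N.
Proof.
rewrite cardsE; apply: (leq_trans (card_size top)).
by rewrite size_take; case: ltnP => // /ltnW.
Qed.

(** Exchange argument: utilizations in [B :\: C] are at most the threshold [v], those in [C :\: B]
    at least [v], and the latter set is at least as large. *)
Lemma Umax_ge (B : {set 'I_n.+1}) : (#|B| <= (nprocs pf).-1)%N ->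
  \sum_(i in B) util ts i <= Umax pf ts.
Proof.
move=> Bm; rewrite UmaxE; set C := [set i in top]%SET.
have size_s : size byutil = n.+1 by rewrite size_sort size_enum_ord.
have mem_s i : i \in byutil by rewrite mem_sort mem_enum.
have index_lt i : (index i byutil < n.+1)%N by rewrite -[X in (_ < X)%N]size_s index_mem.
have s_uniq : uniq byutil by rewrite sort_uniq enum_uniq.
have s_sorted : sorted (relpre (util ts) >=%R) byutil.
  by apply: sort_sorted => i j; exact: ge_total.
have le_nth i j : (i <= j < n.+1)%N ->
    util ts (nth ord0 byutil j) <= util ts (nth ord0 byutil i).
  case/andP=> ij jn.
  have tr : transitive (relpre (util ts) >=%R) by move=> x y w /= xy yw; exact: le_trans yw xy.
  have rf : reflexive (relpre (util ts) >=%R) by move=> x /=.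
  apply: (sorted_leq_nth tr rf ord0 s_sorted) => //; rewrite inE size_s //.
  exact: leq_ltn_trans ij jn.
have inC i : (i \in C) = (index i byutil < (nprocs pf).-1)%N.
  rewrite inE; apply/idP/idP => [|h]; last by rewrite in_take.
  by rewrite in_take.
have [BC|/subsetPn[y yB yC]] := boolP (B \subset C).
  rewrite [leRHS](big_setID B) /= (finset.setIidPr BC) lerDl.
  by apply: sumr_ge0 => i _; rewrite ltW ?util_gt0.
have kn : ((nprocs pf).-1 < n.+1)%N.
  rewrite inC -leqNgt in yC; apply: leq_ltn_trans yC (index_lt y).
have sizeC : #|C| = (nprocs pf).-1.
  rewrite /C cardsE; have /card_uniqP -> : uniq top by rewrite take_uniq.
  by rewrite size_takel // size_s ltnW.
pose v := util ts (nth ord0 byutil (nprocs pf).-1).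
have v0 : 0 <= v by rewrite ltW ?util_gt0.
have leDv : \sum_(i in B :\: C) util ts i <= v *+ #|B :\: C|.
  rewrite -sumr_const; apply: ler_sum => i; rewrite inE inC -leqNgt => /andP[ki _].
  by rewrite -[i in leLHS](nth_index ord0 (mem_s i)) le_nth // ki index_lt.
have geDv : v *+ #|C :\: B| <= \sum_(i in C :\: B) util ts i.
  rewrite -sumr_const; apply: ler_sum => i; rewrite inE inC => /andP[_ ki].
  by rewrite -[i in leRHS](nth_index ord0 (mem_s i)) le_nth // kn ltnW.
rewrite (big_setID C) /= [leRHS](big_setID B) /= finset.setIC lerD2l.
apply: le_trans leDv (le_trans _ geDv); apply: ler_wpMn2l => //.
by rewrite !cardsD sizeC finset.setIC leq_sub2r.
Qed.

(** The increments with [a k < u] telescope from [a 0] to a value that is at least [u], unless the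
    sequence ends below [u]; the minimum covers that case. *)
Lemma layer_cake (a : nat -> R) (u : R) N : (forall k, a k <= a k.+1) ->
  Num.min u (a N) <= a 0%N + \sum_(k < N) (a k < u)%R%:R * (a k.+1 - a k).
Proof.
move=> a_mono; elim: N => [|N IH]; first by rewrite big_ord0 addr0 ge_min lexx orbT.
rewrite big_ord_recr /=; have [aNu|uaN] := ltP (a N) u.
  rewrite mul1r; move: IH; rewrite (min_idPr (ltW aNu)) => IH.
  by rewrite ge_min; apply/orP; right; lra.
rewrite mul0r addr0; move: IH; rewrite (min_idPl uaN) => IH.
by rewrite ge_min IH.
Qed.

Context (util_le_alpha : forall i : 'I_n.+1, util ts i <= alpha pf ord_max).
Context (card_Phi_le : forall k : 'I_z.+1, (k < z)%N ->
  (#|Phi pf ts k| <= #|Psi pf k|)%N).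

(* Writing each speed and each utilization as 1 plus the speed steps below it,
   the hypothesis on [Phi] and [Psi] compares the two sums step by step. *)
Lemma sum_util_le (B : {set 'I_n.+1}) : (#|B| <= (nprocs pf).-1)%N ->
  \sum_(i in B) util ts i + 1 <= Rsum pf.
Proof.
(* Clamping the index at [z] makes [a] monotone on all naturals, as [layer_cake] requires. *)
move=> Bm; pose a k := alpha pf (inord (minn k z)).
have a_mono k : a k <= a k.+1.
  by apply: alpha_mono; rewrite !inordK ?ltnS ?geq_minr //; lia.
have aE (k : 'I_z.+1) : a k = alpha pf k.
  rewrite /a; congr (alpha pf _); apply/val_inj; rewrite /= inordK ?ltnS ?geq_minr //.
  by apply/minn_idPl; rewrite -ltnS.
have az : a z = alpha pf ord_max by rewrite -(aE ord_max).
have a0 : a 0%N = 1 by rewrite -(alpha_slowest pf) -(aE ord0).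
pose D k := a k.+1 - a k.
have D0 k : 0 <= D k by rewrite subr_ge0.
have utilB : \sum_(i in B) util ts i
    <= #|B|%:R + \sum_(k < z) #|Psi pf (inord k)|%:R * D k.
  apply: le_trans (_ : \sum_(i in B) (1 + \sum_(k < z) (a k < util ts i)%R%:R * D k) <= _).
    apply: ler_sum => i _; have := layer_cake (util ts i) z a_mono.
    by rewrite a0 (min_idPl _) // az.
  rewrite big_split /= sumr_const lerD2l exchange_big /=; apply: ler_sum => k _.
  rewrite -mulr_suml; apply: ler_wpM2r => //.
  rewrite -natr_sum ler_nat; have kz : (inord k : 'I_z.+1) = k :> nat.
    by rewrite inordK // ltnS ltnW.
  apply: leq_trans (card_Phi_le (k := inord k) _); last by rewrite kz.
  rewrite -sum1_card big_mkcond [leqRHS]big_mkcond /=.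
  apply: leq_sum => i _; rewrite inE -aE kz; case: ifP => //; by case: ltP.
have speedE : Rsum pf = (nprocs pf)%:R + \sum_(k < z) #|Psi pf (inord k)|%:R * D k.
  rewrite RsumE (eq_bigr (fun q => 1 + \sum_(k < z) (k < kind q)%N%:R * D k)).
    rewrite big_split /= sumr_const; congr (_ + _).
    rewrite exchange_big /=; apply: eq_bigr => k _; rewrite -mulr_suml; congr (_ * _).
    rewrite -natr_sum -sum1_card [in RHS]big_mkcond /=; congr _%:R.
    have kz : (inord k : 'I_z.+1) = k :> nat by rewrite inordK // ltnS ltnW.
    by apply: eq_bigr => q _; rewrite in_Psi kz; case: (_ < _)%N.
  move=> q _; rewrite /speed -aE.
  have: (kind q <= z)%N by rewrite -ltnS.
  elim: (nat_of_ord (kind q)) => [|k IH] kz.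
    by rewrite a0 big1 ?addr0 // => k _; rewrite mul0r.
  transitivity (D k + a k); first by rewrite /D subrK.
  rewrite {}(IH (ltnW kz)) addrCA; congr (_ + _).
  rewrite [RHS](bigD1 (Ordinal kz)) //= [in LHS](bigD1 (Ordinal kz)) //=.
  rewrite ltnn ltnSn mulr0n mulr1n mul0r mul1r add0r; congr (_ + _).
  apply: eq_bigr => j jk; rewrite [in RHS]ltnS [in RHS]leq_eqVlt.
  suff -> : (nat_of_ord j == k) = false by [].
  by apply/negbTE; apply: contra jk => /eqP jk; apply/eqP/val_inj.
(* The slack of 1 in the conclusion comes from a processor left over by [B], with its base speed
   1. *)
have : (#|B|.+1%:R : R) <= (nprocs pf)%:R.
  by rewrite ler_nat -(prednK nprocs_gt0).
rewrite -natr1; lra.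
Qed.

Lemma Umax_le : Umax pf ts + 1 <= Rsum pf.
Proof. by rewrite UmaxE; apply: sum_util_le; exact: card_top_le. Qed.

End PlatformBounds.

(** * The lag bound *)

(** The arithmetic of the exchange case of [lag_bound_le]; [D] is what [Rs - total_util] becomes
    when a task of utilization [M] is exchanged for [uh]. Multiplied by [D], the difference of the
    two sides is the sum of four nonnegative terms built from the hypotheses. *)
Lemma swap_inequality (R : realFieldType) (r U M uh y P E : R) :
  0 <= r -> 0 <= P -> 0 <= U -> uh <= 1 -> M <= uh -> 1 <= r - U - (uh - M) ->
  P * (U + uh) <= E -> E - P <= (r - U - (uh - M)) * y ->
  r * E <= (r - U) * (r * y + P * (uh + r * (1 - uh))) + P * M * U.
Proof.
move=> r0 P0 U0 uh1 Muh D1 E_ge y_ge; set D := r - U - (uh - M) in D1 y_ge.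
have D0 : 0 < D by exact: lt_le_trans ltr01 D1.
have dM0 : 0 <= uh - M by rewrite subr_ge0.
have uh0 : 0 <= 1 - uh by rewrite subr_ge0.
have rUE : r - U = D + (uh - M) by rewrite /D; ring.
have rU0 : 0 <= r - U by rewrite rUE addr_ge0 // ltW.
rewrite -(ler_pM2l D0).
have h1 : r * (r - U) * (E - P) <= r * (r - U) * (D * y).
  by rewrite ler_wpM2l // mulr_ge0.
have h2 : r * (uh - M) * (P * (U + uh)) <= r * (uh - M) * E.
  by rewrite ler_wpM2l // mulr_ge0.
have h3 : 0 <= P * ((r - U) * (D - 1) * (1 - uh) * r).
  by rewrite !mulr_ge0 // subr_ge0.
have h4 : 0 <= P * ((uh - M) * (U * U + (uh - M) * U)).
  by rewrite mulr_ge0 // mulr_ge0 // addr_ge0 // mulr_ge0.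
rewrite -subr_ge0; set d := (X in 0 <= X).
suff -> : d = (r * (r - U) * (D * y) - r * (r - U) * (E - P))
   + (r * (uh - M) * E - r * (uh - M) * (P * (U + uh)))
   + P * ((r - U) * (D - 1) * (1 - uh) * r)
   + P * ((uh - M) * (U * U + (uh - M) * U)).
  by apply: (addr_ge0 (addr_ge0 (addr_ge0 _ _) h3) h4); rewrite subr_ge0.
by rewrite /d /D; ring.
Qed.

Section LagBound.
Context {R : realType} {z n : nat} (pf : platform R z) (ts : task_system R n).
Context (util_le_alpha : forall i : 'I_n.+1, util ts i <= alpha pf ord_max).
Context (card_Phi_le : forall k : 'I_z.+1, (k < z)%N ->
  (#|Phi pf ts k| <= #|Psi pf k|)%N).

Local Notation Rs := (Rsum pf).
Local Notation P := (pmin ts).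
Local Notation x := (xbound pf ts).
Implicit Types A B : {set 'I_n.+1}.

Definition maxutil A : R := \big[Num.max/0]_(i in A) util ts i.
Definition capped_maxutil : R := Num.min 1 (maxutil [set: 'I_n.+1]%SET).
Local Notation uh := capped_maxutil.
Definition total_cost A : R := \sum_(i in A) cost ts i.
Definition total_util A : R := \sum_(i in A) util ts i.

(* A waiting job of task k whose deadline passed X time units ago satisfies
   [Rs * X + remaining work <= Gbound].  The second summand is the largest
   constant for which this still gives the response time [x + 2 * period k]
   whatever k is, see [Gbound_le]. *)
Definition Gbound : R := Rs * x + P * (uh + Rs * (1 - uh)).

(* Bounds the total lag of tasks of A executing simultaneously; the term in
   [maxutil] is what makes [- pmin] in [xbound] affordable. *)
Definition lag_bound A : R :=
  total_cost A + total_util A * (Gbound - P * maxutil A) / Rs.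

Local Lemma Rs_gt0 : 0 < Rs. Proof. exact: lt_le_trans ltr01 (Rsum_ge1 pf). Qed.

Lemma maxutil_ge0 A : 0 <= maxutil A.
Proof. by rewrite /maxutil; elim/big_rec: _ => // i y _ y0; rewrite le_max y0 orbT. Qed.

Lemma util_le_maxutil A i : i \in A -> util ts i <= maxutil A.
Proof. exact: le_bigmax_cond. Qed.

Lemma maxutil_attained A : A != finset.set0 -> exists2 i, i \in A & maxutil A = util ts i.
Proof.
case/set0Pn => i0 i0A; pose i := [arg max_(i > i0 in A) util ts i]%O.
have [iA imax] : i \in A /\ forall j, j \in A -> util ts j <= util ts i.
  by rewrite /i; case: arg_maxP.
exists i => //; apply/le_anti; rewrite util_le_maxutil // andbT.
by apply/bigmax_leP; split => //; rewrite ltW ?util_gt0.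
Qed.

Lemma total_util_ge0 A : 0 <= total_util A.
Proof. by apply: sumr_ge0 => i _; rewrite ltW ?util_gt0. Qed.

Lemma total_cost_ge A : P * total_util A <= total_cost A.
Proof. by rewrite mulrC mulr_suml; apply: ler_sum => i _; exact: util_pmin_le_cost. Qed.

Lemma maxutil_le_total A : maxutil A <= total_util A.
Proof.
apply/bigmax_leP; split=> [|i iA]; first exact: total_util_ge0.
by rewrite /total_util (bigD1 i) //= lerDl sumr_ge0 // => j _; rewrite ltW ?util_gt0.
Qed.

Lemma xbound_ge0 : 0 <= x. Proof. by rewrite le_max lexx. Qed.

Lemma Rsum_sub_Umax_ge1 : 1 <= Rs - Umax pf ts.
Proof. by rewrite lerBrDl; exact: Umax_le. Qed.

Lemma xbound_ge (d : R) : Rs - Umax pf ts <= d -> Estar pf ts - P <= d * x.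
Proof.
move=> hd; apply: le_trans (_ : (Rs - Umax pf ts) * x <= _); last first.
  by rewrite ler_wpM2r ?xbound_ge0.
have h : 0 < Rs - Umax pf ts by exact: lt_le_trans ltr01 Rsum_sub_Umax_ge1.
by rewrite mulrC -ler_pdivrMr // le_max lexx orbT.
Qed.

Lemma capped_maxutil_bounds : 0 <= uh <= 1.
Proof. by rewrite le_min ler01 maxutil_ge0 ge_min lexx. Qed.

(** If [util ts i <= 1] then [util ts i <= uh], and since [Rs >= 1] the expression
    [uh + Rs * (1 - uh)] can only grow when [uh] is lowered to [util ts i]; multiplied by the period
    it is then [cost ts i + Rs * (period ts i - cost ts i)]. Otherwise [uh = 1] and
    [P <= period ts i <= cost ts i]. *)
Lemma Gbound_le i :
  Gbound <= Rs * (x + Num.max 0 (period ts i - cost ts i)) + cost ts i.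
Proof.
have [[[Rs1 P0] Pp] p0] := (Rsum_ge1 pf, pmin_gt0 ts, pmin_le ts i, period_gt0 ts i).
rewrite /Gbound [Rs * (x + _)]mulrDr -addrA lerD2l.
have [uh0 uh1] := andP capped_maxutil_bounds.
have u0 := util_gt0 ts i.
have [u1|u1] := leP (util ts i) 1.
  have uuh : util ts i <= uh by rewrite le_min u1 util_le_maxutil // inE.
  rewrite (max_idPr _) ?subr_ge0 costE; last by rewrite ger_pMl.
  have h1 : uh + Rs * (1 - uh) <= util ts i + Rs * (1 - util ts i) by nra.
  apply: le_trans (_ : period ts i * (util ts i + Rs * (1 - util ts i)) <= _); last by lra.
  by apply: ler_pM => //; [exact: ltW | nra].
have -> : uh = 1.
  by apply/min_idPl; apply: le_trans (ltW u1) _; rewrite util_le_maxutil // inE.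
rewrite subrr mulr0 addr0 mulr1; apply: ler_wpDl.
  by rewrite mulr_ge0 ?(ltW Rs_gt0) // le_max lexx.
by rewrite costE; nra.
Qed.

(** This closes the delay bound: [A] will be the preceding tasks executing at a quiet time, and [B]
    adds the non-preceding ones, each charged one full job. After multiplication by [Rs], the
    definition of [xbound] covers everything but [Rs * P], which must come from the second summand
    of [Gbound] and from [P * maxutil A * total_util A]. *)
Lemma lag_bound_le A B : A \subset B -> (#|A| <= (nprocs pf).-1)%N ->
  (#|B| <= nprocs pf)%N ->
  total_cost B + total_util A * (Gbound - P * maxutil A) / Rs <= Gbound.
Proof.
move=> AB cA cB; have SE : total_cost B <= Estar pf ts by exact: Estar_ge.
have [[[Rs1 P0] x0] uhb] := (Rsum_ge1 pf, pmin_gt0 ts, xbound_ge0, capped_maxutil_bounds).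
case/andP: uhb => uh0 uh1.
have UA := Umax_ge ts cA; rewrite -/(total_util A) in UA.
have D1 := Rsum_sub_Umax_ge1.
have U0 := total_util_ge0 A; have M0 := maxutil_ge0 A.
set S := total_cost B in SE *; set U := total_util A in UA U0 *.
set M := maxutil A in M0 *.
rewrite -lerBrDl ler_pdivrMr ?Rs_gt0 //.
suff : Rs * S <= (Rs - U) * Gbound + P * M * U by lra.
rewrite /Gbound; have [A0|A0] := eqVneq A finset.set0.
  have -> : U = 0 by rewrite /U /total_util A0 big_set0.
  have h := @xbound_ge Rs _; rewrite subr0 mulr0 addr0 ler_pM2l ?Rs_gt0 //.
  apply: le_trans (_ : (Estar pf ts - P) + P <= _); first by rewrite subrK.
  apply: lerD; first by apply: h; lra.
  rewrite ler_peMr ?(ltW P0) //.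
  have : 0 <= (Rs - 1) * (1 - uh) by rewrite mulr_ge0 //; lra.
  by lra.
have [uhM|Muh] := leP uh M.
  have h := @xbound_ge (Rs - U) _.
  have {}h : S - P <= (Rs - U) * x by apply: le_trans (h _); lra.
  have h1 : Rs <= (Rs - U) * (uh + Rs * (1 - uh)) + M * U.
    have : uh * U <= M * U by exact: ler_wpM2r.
    have : 0 <= (Rs - U - 1) * (Rs * (1 - uh)).
      by rewrite !mulr_ge0 ?(ltW Rs_gt0) //; lra.
    by lra.
  have h2 : P * Rs <= P * ((Rs - U) * (uh + Rs * (1 - uh)) + M * U).
    by rewrite ler_pM2l.
  have h3 : Rs * (S - P) <= Rs * ((Rs - U) * x) by rewrite ler_pM2l ?Rs_gt0.
  by lra.
(* No task of A reaches the utilization uh: in the bounds on Umax and Estar,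
   exchange the task of largest utilization in A for one that does. *)
have [|k _ kE] := @maxutil_attained [set: 'I_n.+1]%SET.
  by apply/set0Pn; exists ord0; rewrite inE.
have uhk : uh <= util ts k by rewrite -kE ge_min lexx orbT.
have kA : k \notin A.
  apply/negP => /util_le_maxutil; rewrite -/M => kM; lra.
have [b bA bE] := maxutil_attained A0; rewrite -/M in bE.
have kAb : k \notin A :\ b by rewrite inE (negbTE kA) andbF.
have U' : U - M + uh <= Umax pf ts.
  apply: le_trans (@Umax_ge R z n pf ts (k |: A :\ b) _); last first.
    by rewrite cardsU1 kAb; move: cA; rewrite (cardsD1 b A) bA.
  rewrite big_setU1 //= /U /total_util (big_setD1 b) //= bE; lra.
have SkE : total_cost A + cost ts k <= Estar pf ts.
  apply: le_trans (@Estar_ge R z n pf ts (k |: A) _).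
    by rewrite big_setU1 //= addrC.
  by rewrite cardsU1 kA add1n -(prednK (nprocs_gt0 pf)) ltnS.
have kc := util_pmin_le_cost ts k; have Ac := total_cost_ge A; rewrite -/U in Ac.
set E := Estar pf ts in SE SkE *.
have E_ge : P * (U + uh) <= E.
  apply: le_trans SkE; rewrite mulrDr; apply: lerD => //.
  by apply: le_trans kc; rewrite mulrC ler_pM2r.
apply: le_trans (_ : Rs * E <= _); first by rewrite ler_pM2l ?Rs_gt0.
apply: swap_inequality => //; rewrite ?(ltW Muh) ?(ltW P0) ?(ltW Rs_gt0) //.
  by lra.
by apply: xbound_ge; lra.
Qed.

(** The multiples of [Gbound] cancel identically. The slack left in the costs is estimated by
    [total_cost_ge] and dominates the change of the correction terms; the two cases are whether or
    not [i] alone attains the maximal utilization. *)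
Lemma lag_bound_setD1 A i : i \in A -> total_util A <= Rs ->
  (Rs - total_util A) * (lag_bound (A :\ i) + cost ts i) + util ts i * Gbound
    <= (Rs - total_util A + util ts i) * lag_bound A.
Proof.
move=> iA UR; have [P0 u0] := (pmin_gt0 ts, util_gt0 ts i).
have EE : total_cost A = cost ts i + total_cost (A :\ i) by exact: big_setD1.
have UE : total_util A = util ts i + total_util (A :\ i) by exact: big_setD1.
have ME : maxutil A <= Num.max (util ts i) (maxutil (A :\ i)).
  apply/bigmax_leP; split=> [|j jA]; first by rewrite le_max maxutil_ge0 orbT.
  rewrite le_max; have [->|ji] := eqVneq j i; first by rewrite lexx.
  by rewrite util_le_maxutil ?orbT // !inE ji.
have Ege := total_cost_ge A; have MV := maxutil_le_total (A :\ i).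
have M0 := maxutil_ge0 (A :\ i).
rewrite /lag_bound EE; rewrite EE in Ege; rewrite UE in UR Ege *.
set V := total_util (A :\ i) in MV UE UR Ege *; set M := maxutil (A :\ i) in ME MV M0 *.
set u := util ts i in u0 ME UE UR Ege *; set e := _ + total_cost _ in Ege *.
set M' := maxutil A in ME *; set g := Gbound.
have -> : total_cost (A :\ i) = e - cost ts i by rewrite /e; lra.
have key : P * ((Rs - V) * (M' * (V + u) - M * V) + u * M * V) <= Rs * u * e.
  have V0 : 0 <= V by lra.
  have h : Rs * u * (P * (u + V)) <= Rs * u * e.
    by apply: ler_wpM2l => //; rewrite mulr_ge0 ?(ltW Rs_gt0) ?(ltW u0).
  apply: le_trans h; rewrite [leRHS](_ : _ = P * (Rs * u * (u + V))); last by lra.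
  rewrite ler_pM2l //.
  have RV : 0 <= Rs - V by lra.
  have VU : 0 <= V + u by lra.
  have h1 : (Rs - V) * (M' * (V + u)) <= (Rs - V) * (Num.max u M * (V + u)).
    by rewrite ler_wpM2l // ler_wpM2r.
  move: h1; have [uM|Mu] := leP u M => h1.
    have h2 : Rs * u * M <= Rs * u * (u + V).
      by apply: ler_wpM2l; [rewrite mulr_ge0 ?(ltW Rs_gt0) ?(ltW u0) | lra].
    by lra.
  have h2 : 0 <= (Rs - V - u) * (M * V) by rewrite !mulr_ge0 //; lra.
  have h3 : 0 <= V * (u * (u + V)) by rewrite mulr_ge0 // mulr_ge0 ?(ltW u0) // addr_ge0 ?(ltW u0).
  by lra.
rewrite -(ler_pM2l Rs_gt0) -subr_ge0.
set lhs := (X in 0 <= X).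
suff -> : lhs = Rs * u * e - P * ((Rs - V) * (M' * (V + u) - M * V) + u * M * V).
  by rewrite subr_ge0.
by rewrite /lhs; field; rewrite gt_eqF ?Rs_gt0.
Qed.

End LagBound.

(** * Service received by jobs *)

Section StepFunctions.
Context {R : realType} (f : R -> R).
Context (f_right : forall t, exists2 eps : R, 0 < eps &
  forall s, t <= s < t + eps -> f s = f t).
Context (f_left : forall t, exists c eps, 0 < eps /\
  forall s, t - eps < s < t -> f s = c).
Context (K : R) (f_bounded : forall t, `|f t| <= K).

(** The value at [b] is left free, because a step function may jump there. *)
Lemma measurable_const_itv (a b c : R) :
  (forall u, a < u < b -> f u = c) -> measurable_fun `]a, b] f.
Proof.
move=> fc; apply/measurable_realfun.measurable_fun_itv_bndo_bndcP.
apply: (@eq_measurable_fun _ _ _ _ _ (cst c)); last exact: measurable_cst.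
by move=> u; rewrite inE /= in_itv /= => /fc ->.
Qed.

Lemma measurable_step (a b : R) : measurable_fun `[a, b] f.
Proof.
have extend s t : a <= s -> s <= t -> measurable_fun `[a, s] f ->
    measurable_fun `]s, t] f -> measurable_fun `[a, t] f.
  move=> as_ st ms mt.
  rewrite (@itv_bndbnd_setU _ _ (BLeft a) (BRight s) (BRight t)) ?bnd_simp //.
  by apply/measurable_funU.
have [ab|ba] := leP a b; last first.
  by rewrite set_itv_ge ?bnd_simp -?ltNge //; exact: measurable_fun_set0.
apply: (@real_induction _ a b (fun t => measurable_fun `[a, t] f)) => //.
- by rewrite set_itv1; exact: measurable_fun_set1.
- move=> t /andP[at_ _] mt; have [eps eps0 fe] := f_right t.
  exists eps => // s /andP[ts se]; apply: (extend t) => //; first exact: ltW.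
  apply: (@measurable_const_itv _ _ (f t)) => u /andP[tu us].
  by apply: fe; rewrite (ltW tu) (lt_trans us).
- move=> t /andP[at_ _] IH; have [c [eps [eps0 fe]]] := f_left t.
  pose s := Num.max a (t - eps).
  have as_ : a <= s by rewrite le_max lexx.
  have st : s < t by rewrite gt_max at_ /=; lra.
  apply: (extend s) => //; [exact: ltW | by apply: IH; rewrite as_ |].
  apply: (@measurable_const_itv _ _ c) => u /andP[su ut].
  by apply: fe; rewrite ut andbT; apply: le_lt_trans su; rewrite le_max lexx orbT.
Qed.

Lemma integrable_step (a b : R) :
  lebesgue_measure.-integrable `[a, b] (EFin \o f).
Proof.
apply: measurable_bounded_integrable => //.
- apply: (@le_lt_trans _ _ (lebesgue_measure (`[a, b]%classic : set R))) => //.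
  by rewrite lebesgue_measure_itv; case: ifP => //= _; rewrite -EFinB ltry.
- exact: measurable_step.
- exists K; split; first exact: num_real.
  by move=> M KM t _ /=; apply: le_trans (f_bounded t) (ltW KM).
Qed.

Lemma integral_step (r s t c : R) : r <= s -> s <= t ->
  (forall u, s < u < t -> f u = c) ->
  (\int[lebesgue_measure]_(u in `[r, t]) f u)%R
    = (\int[lebesgue_measure]_(u in `[r, s]) f u)%R + c * (t - s).
Proof.
move=> rs st fc; have UE : (`[r, t] = `[r, s] `|` `]s, t])%classic.
  by rewrite -(@itv_bndbnd_setU _ _ (BLeft r) (BRight s) (BRight t)) ?bnd_simp.
have it : lebesgue_measure.-integrable `]s, t] (EFin \o f).
  apply: integrableS (integrable_step r t) => //.
  by rewrite UE; exact: subsetUr.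
rewrite UE Rintegral_setU //; last 2 first.
- by rewrite -UE; exact: integrable_step.
- by apply: lt_disjoint => u v; rewrite !in_itv /= => /andP[_ us] /andP[sv _]; apply: le_lt_trans sv.
congr (_ + _); rewrite -Rintegral_itv_bndo_bndc; last first.
  by apply: integrableS it => //; apply: subset_itvl; rewrite bnd_simp.
rewrite (@eq_Rintegral _ _ _ _ _ (cst c)); last first.
  by move=> u; rewrite inE /= in_itv /= => /fc.
rewrite Rintegral_cst //; congr (_ * _).
transitivity (fine (lebesgue_measure (`]s, t[%classic : set R))) => //.
rewrite lebesgue_measure_itv /= lte_fin.
have [<-|st'] := eqVneq s t; first by rewrite ltxx subrr.
by rewrite lt_neqAle st' st.
Qed.

End StepFunctions.

Section Service.
Context {R : realType} {z n : nat} (pf : platform R z) (ts : task_system R n).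
Context (js : job_sequence ts) (sched : schedule n pf).
Context (Hs : np_gedf_h js sched).

Local Notation Rs := (Rsum pf).
Local Notation rate := (rate sched).
Local Notation serv := (service js sched).
Local Notation enabled := (enabled js sched).
Local Notation completed := (completed js sched).
Implicit Types (J : job n) (s t : R) (A : assignment n pf) (i : 'I_n.+1).

(** [rate J t] is convertible to [arate (sched t) J]; as a function of the assignment it is constant
    along a step. *)
Definition arate A J : R := \sum_(q : proc pf | A q == Some J) speed q.

Lemma arate_ge0 A J : 0 <= arate A J.
Proof. by apply: sumr_ge0 => q _; exact: speed_ge0. Qed.

Lemma arate_le A J : arate A J <= Rs.
Proof.
rewrite RsumE [leRHS](bigID (fun q => A q == Some J)) /= lerDl.
by apply: sumr_ge0 => q _; exact: speed_ge0.
Qed.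

Lemma arate_not_running A J : ~~ running A J -> arate A J = 0.
Proof. by move=> /existsPn nr; rewrite /arate big_pred0 // => q; apply/negbTE/nr. Qed.

Lemma running_enabled t J : running (sched t) J -> enabled J t.
Proof. by case/existsP=> q /eqP; exact: (only_enabled Hs). Qed.

Lemma enabled_released t J : enabled J t -> release js J.1 J.2 <= t.
Proof. by case/and3P. Qed.

Lemma enabled_not_completed t J : enabled J t -> ~~ completed J t.
Proof. by case/and3P. Qed.

Lemma sched_left t : exists A eps, 0 < eps /\
  forall s, t - eps < s < t -> sched s = A.
Proof. by have [A [eps [eps0 Ae _]]] := scheduler_step Hs t; exists A, eps. Qed.

Lemma sched_right t : exists2 eps : R, 0 < eps &
  forall s, t <= s < t + eps -> sched s = sched t.
Proof. exact: (right_constant Hs). Qed.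

Lemma serv_before_release J t : t <= release js J.1 J.2 -> serv J t = 0.
Proof.
rewrite /service le_eqVlt => /orP[/eqP <-|tr]; first by rewrite set_itv1 Rintegral_set1.
by rewrite set_itv_ge ?bnd_simp -?ltNge // Rintegral_set0.
Qed.

Lemma serv_step J s t A : s <= t -> (forall u, s < u < t -> sched u = A) ->
  serv J t = serv J s + arate A J * (t - s).
Proof.
set r := release js J.1 J.2 => st sA.
have step s' : r <= s' -> s <= s' -> s' <= t ->
    serv J t = serv J s' + arate A J * (t - s').
  move=> rs' ss' s't; apply: (@integral_step _ (rate J) _ _ Rs) => //.
  - move=> v; have [eps eps0 se] := sched_right v; exists eps => // w /se wv.
    by rewrite /rate wv.
  - move=> v; have [B [eps [eps0 se]]] := sched_left v; exists (arate B J), eps.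
    by split=> // w /se wv; rewrite /rate wv.
  - by move=> v; rewrite ger0_norm ?arate_ge0 ?arate_le.
  - move=> u /andP[su ut]; rewrite /rate sA // ut andbT.
    exact: le_lt_trans su.
have [rs|sr] := leP r s; first exact: step.
have [<-|st'] := eqVneq s t; first by rewrite subrr mulr0 addr0.
have ltst : s < t by rewrite lt_neqAle st' st.
(* Here [s] is before the release, so [A] is in force at some instant before it; only enabled jobs
   execute, hence [A] does not execute [J]. *)
have A0 : arate A J = 0.
  pose m := Num.min r t; have sm : s < m by rewrite lt_min sr.
  have um : (s + m) / 2 < m by rewrite ltr_pdivrMr //; lra.
  have su : s < (s + m) / 2 by rewrite ltr_pdivlMr //; lra.
  have [mr mt] : m <= r /\ m <= t by rewrite /m !ge_min !lexx orbT.
  rewrite -(sA ((s + m) / 2)) ?su ?(lt_le_trans um) //; apply: arate_not_running.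
  apply/negP => /running_enabled/enabled_released; apply/negP; rewrite -ltNge.
  exact: lt_le_trans mr.
rewrite A0 mul0r addr0 (serv_before_release (ltW sr)).
have [tr|rt] := leP t r; first exact: serv_before_release.
rewrite (step r) // ?A0 ?mul0r ?serv_before_release ?addr0 //; exact: ltW.
Qed.

(** Total service minus [rho] times the time is locally nondecreasing, because the assignment is
    constant shortly before and shortly after every instant. *)
Lemma serv_lower (S : seq (job n)) a b rho : a <= b ->
  (forall t, a < t < b -> rho <= \sum_(J <- S) rate J t) ->
  rho * (b - a) <= \sum_(J <- S) (serv J b - serv J a).
Proof.
move=> ab Hrho; rewrite sumrB.
have step s t A : a <= s -> s < t -> t <= b -> (forall u, s < u < t -> sched u = A) ->
    \sum_(J <- S) serv J s - rho * s <= \sum_(J <- S) serv J t - rho * t.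
  move=> as_ st tb sA.
  rewrite [X in _ <= X - _](eq_bigr _ (fun J _ => serv_step J (ltW st) sA)).
  rewrite big_split /= -mulr_suml.
  have u1 : s < (s + t) / 2 by rewrite ltr_pdivlMr //; lra.
  have u2 : (s + t) / 2 < t by rewrite ltr_pdivrMr //; lra.
  have : rho <= \sum_(J <- S) arate A J.
    rewrite -(sA ((s + t) / 2)) ?u1 //; apply: Hrho.
    by rewrite (le_lt_trans as_ u1) (lt_le_trans u2).
  rewrite -subr_ge0 => h; have {}h := mulr_ge0 h (_ : 0 <= t - s).
  by rewrite subr_ge0 in h; have {}h := h (ltW st); lra.
suff : \sum_(J <- S) serv J a - rho * a <= \sum_(J <- S) serv J b - rho * b by lra.
apply: (@le_of_locally_nondecreasing _ a b (fun t => \sum_(J <- S) serv J t - rho * t)) => //.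
- move=> t /andP[at_ tb]; have [eps eps0 se] := sched_right t.
  exists (Num.min eps (b - t)); first by rewrite lt_min eps0 subr_gt0.
  move=> s; rewrite -ltrBlDl lt_min => /and3P[lts se' sb]; apply: (step _ _ (sched t)) => //.
    by move: sb; rewrite ltrD2r => /ltW.
  move=> u /andP[tu us]; apply: se; rewrite (ltW tu) /=; apply: lt_trans us _.
  by rewrite -ltrBlDl.
- move=> t /andP[at_ tb]; have [A [eps [eps0 se]]] := sched_left t.
  exists (Num.min eps (t - a)); first by rewrite lt_min eps0 subr_gt0.
  move=> s; rewrite ltrBlDr -ltrBlDl lt_min => /andP[/andP[se' sa] st].
  apply: (step _ _ A) => //; first by move: sa; lra.
  move=> u /andP[su ut]; apply: se; rewrite ut andbT; move: se' su; lra.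
Qed.

Lemma serv_mono J s t : s <= t -> serv J s <= serv J t.
Proof.
move=> st; have := @serv_lower [:: J] s t 0 st; rewrite !big_seq1 mul0r subr_ge0; apply.
by move=> u _; rewrite big_seq1 arate_ge0.
Qed.

Lemma serv_ge0 J t : 0 <= serv J t.
Proof.
have [/serv_before_release->//|/ltW rt] := leP t (release js J.1 J.2).
by rewrite -(@serv_before_release J (release js J.1 J.2)) // serv_mono.
Qed.

Lemma serv_const J s t : s <= t ->
  (forall u, s < u < t -> ~~ running (sched u) J) -> serv J t = serv J s.
Proof.
move=> st nr; apply: (@real_induction _ s t
  (fun t' => serv J t' = serv J s)) => //.
- move=> u /andP[su ut] IH; have [eps eps0 se] := sched_right u.
  exists (Num.min eps (t - u)); first by rewrite lt_min eps0 subr_gt0.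
  move=> v; rewrite -ltrBlDl lt_min => /and3P[uv ve vt].
  pose w := (u + v) / 2.
  have uw : u < w by rewrite /w; lra.
  have wv : w < v by rewrite /w; lra.
  rewrite (@serv_step J u v (sched u) (ltW uv)).
    rewrite -IH (@arate_not_running (sched u)) ?mul0r ?addr0 //.
    rewrite -(se w); first by apply: nr; apply/andP; split; lra.
    by apply/andP; split; lra.
  by move=> x /andP[ux xv]; apply: se; apply/andP; split; lra.
- move=> u /andP[su ut] IH; have [A [eps [eps0 se]]] := sched_left u.
  pose v := Num.max s (u - eps / 2).
  have sv : s <= v by rewrite le_max lexx.
  have vu : v < u by rewrite gt_max su /=; lra.
  have ev : u - eps < v by rewrite lt_max; apply/orP; right; lra.
  have vA x : v < x < u -> sched x = A.
    by move=> /andP[vx xu]; apply: se; rewrite xu (lt_trans ev).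
  rewrite (@serv_step J v u A (ltW vu)) // IH ?sv //.
  pose w := (v + u) / 2.
  have vw : v < w by rewrite /w; lra.
  have wu : w < u by rewrite /w; lra.
  rewrite (@arate_not_running A) ?mul0r ?addr0 //.
  by rewrite -(vA w) ?vw //; apply: nr; apply/andP; split; lra.
Qed.

(** A job executes only while incomplete, and its service grows at rate at most [Rs], so it cannot
    jump over the work. *)
Lemma serv_le_work J t : serv J t <= work js J.1 J.2.
Proof.
set w := work js _ _; have w0 : 0 < w := work_gt0 js J.1 J.2.
have Rs0 : 0 < Rs by exact: lt_le_trans ltr01 (Rsum_ge1 pf).
have [/serv_before_release->|/ltW rt] := leP t (release js J.1 J.2); first exact: ltW.
apply: (@real_induction _ _ t (fun t' => serv J t' <= w) rt).
- by rewrite serv_before_release // ltW.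
- move=> u _ IH; have [eps eps0 se] := sched_right u.
  have [runu|nrunu] := boolP (running (sched u) J); last first.
    exists eps => // v /andP[uv ve]; rewrite (@serv_step J u v (sched u) (ltW uv)).
      by rewrite arate_not_running // mul0r addr0.
    by move=> x /andP[ux xv]; apply: se; apply/andP; split; lra.
  have := enabled_not_completed (running_enabled runu); rewrite /completed -ltNge -/w => ltw.
  (* Even all processors together need this long for the remaining work. *)
  exists (Num.min eps ((w - serv J u) / Rs)).
    by rewrite lt_min eps0 divr_gt0 // subr_gt0.
  move=> v; rewrite -ltrBlDl lt_min => /and3P[uv ve vw].
  rewrite (@serv_step J u v (sched u) (ltW uv)); last first.
    by move=> x /andP[ux xv]; apply: se; apply/andP; split; lra.
  rewrite -lerBrDl; apply: le_trans (_ : Rs * (v - u) <= _).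
    by rewrite ler_wpM2r ?arate_le // subr_ge0 ltW.
  by rewrite mulrC -ler_pdivlMr // ltW.
- move=> u /andP[ru ut] IH; have [A [eps [eps0 se]]] := sched_left u.
  apply: (@le_of_lt_add_eps _ _ _ Rs (ltW Rs0)) => eta eta0.
  pose v := Num.max (release js J.1 J.2) (u - Num.min (eps / 2) eta).
  have m0 : 0 < Num.min (eps / 2) eta by rewrite lt_min eta0 divr_gt0.
  have [me meta] : Num.min (eps / 2) eta <= eps / 2 /\ Num.min (eps / 2) eta <= eta.
    by rewrite !ge_min !lexx orbT.
  have rv : release js J.1 J.2 <= v by rewrite le_max lexx.
  have vu : v < u by rewrite gt_max ru /=; lra.
  have uv : u - Num.min (eps / 2) eta <= v by rewrite le_max lexx orbT.
  rewrite (@serv_step J v u A (ltW vu)); last first.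
    by move=> x /andP[vx xu]; apply: se; apply/andP; split; lra.
  apply: lerD; first by apply: IH; rewrite rv.
  apply: ler_pM; rewrite ?arate_ge0 ?arate_le //; lra.
Qed.

Lemma completedE J t : completed J t = (serv J t == work js J.1 J.2).
Proof. by rewrite /completed eq_le serv_le_work. Qed.

Lemma completed_mono J s t : s <= t -> completed J s -> completed J t.
Proof. by move=> st; rewrite /completed => /le_trans -> //; exact: serv_mono. Qed.

Lemma served_ran J t : 0 < serv J t -> exists2 s, s < t & running (sched s) J.
Proof.
move=> s0; apply: contrapT => nex; move: s0.
have [/serv_before_release->|/ltW rt] := leP t (release js J.1 J.2).
  by rewrite ltxx.
rewrite (serv_const rt) ?serv_before_release ?ltxx // => u /andP[_ ut].
by apply/negP => run; apply: nex; exists u.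
Qed.

Lemma served_pred_completed i j t : 0 < serv (i, j.+1) t -> completed (i, j) t.
Proof.
case/served_ran=> s st /running_enabled/and3P[_ _]; exact/completed_mono/ltW.
Qed.

Lemma completed_served J t : completed J t -> 0 < serv J t.
Proof. exact: lt_le_trans (work_gt0 _ _ _). Qed.

(** [enabled] mentions the immediate predecessor only. But a completed predecessor has received
    service, so it was enabled once, and the argument descends to all earlier jobs. *)
Lemma served_below_completed i a b t : (a < b)%N -> 0 < serv (i, b) t -> completed (i, a) t.
Proof.
elim: b => // b IH; rewrite ltnS leq_eqVlt => /orP[/eqP->|ab] /served_pred_completed //.
by move/completed_served/(IH ab).
Qed.

Lemma enabled_below_completed i a b t : (a < b)%N -> enabled (i, b) t -> completed (i, a) t.
Proof.
case: b => // b; rewrite ltnS => ab /and3P[_ _ cb].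
move: ab; rewrite leq_eqVlt => /orP[/eqP->//|ab].
exact: (served_below_completed ab (completed_served cb)).
Qed.

Lemma enabled_unique i a b t : enabled (i, a) t -> enabled (i, b) t -> a = b.
Proof.
move=> ea eb; have [ab|ba|//] := ltngtP a b.
- by have := enabled_not_completed ea; rewrite (enabled_below_completed ab eb).
- by have := enabled_not_completed eb; rewrite (enabled_below_completed ba ea).
Qed.

Lemma serv_above_uncompleted i a b t : ~~ completed (i, a) t -> (a < b)%N -> serv (i, b) t = 0.
Proof.
move=> na ab; apply/le_anti; rewrite serv_ge0 andbT leNgt; apply/negP.
by move/(served_below_completed ab); exact/negP.
Qed.

Lemma release_mono i a b : (a <= b)%N ->
  release js i a + period ts i * (b%:R - a%:R) <= release js i b.
Proof.
elim: b => [|b IH]; first by rewrite leqn0 => /eqP ->; rewrite subrr mulr0 addr0.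
rewrite leq_eqVlt => /orP[/eqP->|]; first by rewrite subrr mulr0 addr0.
rewrite ltnS => /IH h; apply: le_trans (release_sep js i b).
by rewrite -natr1; lra.
Qed.

Lemma first_uncompleted i t :
  exists a, ~~ completed (i, a) t /\ forall j, (j < a)%N -> completed (i, j) t.
Proof.
have ex : exists a, ~~ completed (i, a) t.
  have p0 := period_gt0 ts i.
  pose N := Num.bound `|(t - release js i 0) / period ts i|.
  exists N; rewrite /completed serv_before_release -?ltNge ?work_gt0 //=.
  have := @release_mono i 0 N (leq0n _); rewrite subr0; apply: le_trans.
  rewrite -lerBlDl mulrC -ler_pdivrMr //; apply: le_trans (ler_norm _) _.
  by apply/ltW/archi_boundP.
exists (ex_minn ex); case: ex_minnP => a na amin; split=> // j ja.
by apply: contraLR ja => /amin; rewrite -leqNgt.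
Qed.

(** Time ranges over the whole real line; the idle past is the starting point of the inductions over
    time. *)
Lemma eventually_idle : exists T0, forall t J, t < T0 -> ~~ enabled J t.
Proof.
exists (\big[Num.min/release js ord0 0]_(i < n.+1) release js i 0) => t [i j] tT.
apply/negP => /enabled_released /= rt.
have : release js i 0 <= release js i j.
  apply: le_trans (release_mono i (leq0n j)); rewrite lerDl subr0.
  by rewrite mulr_ge0 ?ler0n // ltW ?period_gt0.
have : \big[Num.min/release js ord0 0]_(i < n.+1) release js i 0 <= release js i 0.
  exact: bigmin_le_cond.
lra.
Qed.

End Service.

(** * The dispatcher *)

Section Dispatch.
Context {R : realType} {z n : nat} (pf : platform R z) (ts : task_system R n).
Context (js : job_sequence ts) (sched : schedule n pf).
Implicit Types (J X : job n) (s t : R) (A : assignment n pf) (D : {set proc pf}).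

Local Notation enabled := (enabled js sched).
Local Notation deadline := (deadline js).
Local Notation hp := (higher_priority js).

Definition fast_enough A := forall q J, A q = Some J -> util ts J.1 <= speed q.

Lemma running_assign A q J X : A q = None ->
  running (assign A q J) X <-> running A X \/ X = J.
Proof.
move=> Aq; split=> [/existsP[q']|[/existsP[q' Aq']|->]].
- rewrite ffunE; case: (q' =P q) => [_ /eqP[->]|_ Aq']; first by right.
  by left; apply/existsP; exists q'.
- apply/existsP; exists q'; rewrite ffunE; case: (q' =P q) => // q'q.
  by rewrite q'q Aq in Aq'.
- by apply/existsP; exists q; rewrite ffunE eqxx.
Qed.

(** A displaced job is overwritten and then placed again, so a move stops no job. *)
Lemma place_running D A J A' : place ts D A J A' ->
  forall X, running A' X <-> running A X \/ X = J.
Proof.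
elim=> {D A J A'} [D A J q _ _ Aq X|D A J k k' q _ _ _ _ Aq X|
  D A J k k' q J' A' _ _ _ _ _ Aq _ _ IH X]; [exact: running_assign..|].
rewrite IH; split.
- case=> [/existsP[q']|->]; last by left; apply/existsP; exists q; rewrite Aq.
  rewrite ffunE; case: (q' =P q) => [_ /eqP[->]|_ Aq']; first by right.
  by left; apply/existsP; exists q'.
- case=> [/existsP[q' Aq']|->]; last first.
    by left; apply/existsP; exists q; rewrite ffunE eqxx.
  have [q'q|q'q] := eqVneq q' q; first by rewrite q'q Aq in Aq'; right; case/eqP: Aq'.
  by left; apply/existsP; exists q'; rewrite ffunE (negbTE q'q).
Qed.

Lemma speed_ge_Psi (k k' : 'I_z.+1) q : k' = k.+1 :> nat -> q \in Psi pf k ->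
  alpha pf k' <= speed q.
Proof. by rewrite in_Psi => k'E kq; apply: alpha_mono; rewrite k'E. Qed.

Lemma place_fast_enough D A J A' : place ts D A J A' -> fast_enough A -> fast_enough A'.
Proof.
have assign_fast B q X : util ts X.1 <= speed q -> fast_enough B ->
    fast_enough (assign B q X).
  move=> uX fB q' Y; rewrite ffunE; case: (q' =P q) => [-> [<-]//|_]; exact: fB.
elim=> {D A J A'} [D A J q u1 _ _|D A J k k' q k'E /andP[_ u] _ qP _|
  D A J k k' q J' A' k'E /andP[_ u] _ _ qP _ _ _ IH] fA.
- by apply: assign_fast => //; apply: le_trans u1 (speed_ge1 q).
- by apply: assign_fast => //; apply: le_trans u (speed_ge_Psi k'E qP).
- by apply/IH/assign_fast => //; apply: le_trans u (speed_ge_Psi k'E qP).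
Qed.

Lemma dispatch_fast_enough t A A' : dispatch js sched t A A' ->
  fast_enough A -> fast_enough A'.
Proof. by elim=> // {}A J B C _ _ _ /place_fast_enough fAB _ IH /fAB. Qed.

Lemma dispatch_running t A A' X : dispatch js sched t A A' -> running A X -> running A' X.
Proof.
by elim=> // {}A J B C _ _ _ pl _ IH rX; apply/IH/(place_running pl); left.
Qed.

Lemma dispatch_full t A A' : dispatch js sched t A A' ->
  (forall q, A' q <> None) \/ (forall J, ~~ waiting js sched t A' J).
Proof. by elim. Qed.

(** A job started by the dispatcher outranked all other jobs waiting at that moment, and those still
    waiting at the end were among them, since dispatching stops no job. *)
Lemma dispatch_new t A A' X : dispatch js sched t A A' -> running A' X ->
  running A X \/ forall J, waiting js sched t A' J -> hp X J.
Proof.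
elim=> [B _ rX|B J C E _ wJ prio pl dCE IH /IH[/(place_running pl)[rB|XJ]|r]];
  [by left|by left| |by right].
right=> J' /andP[eJ' nJ']; rewrite XJ; apply: prio.
  rewrite /waiting eJ'; apply: contra nJ' => rB.
  by apply: (dispatch_running dCE); apply/(place_running pl); left.
apply: contraNneq nJ' => ->.
by apply: (dispatch_running dCE); apply/(place_running pl); right.
Qed.

Context (Hs : np_gedf_h js sched).

Lemma full_or_no_waiting t :
  (forall q, sched t q <> None) \/ (forall J, ~~ waiting js sched t (sched t) J).
Proof. by have [A [eps [_ _ /dispatch_full]]] := scheduler_step Hs t. Qed.

Lemma waiting_full t J : waiting js sched t (sched t) J -> forall q, sched t q <> None.
Proof. by move=> wJ; have [//|/(_ J)/negP] := full_or_no_waiting t. Qed.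

Lemma started_or_was_running t X : running (sched t) X ->
  (exists2 eps : R, 0 < eps & forall s, t - eps < s < t -> running (sched s) X) \/
  (forall J, waiting js sched t (sched t) J -> hp X J).
Proof.
have [A [eps [eps0 Ae dA]]] := scheduler_step Hs t.
move/(dispatch_new dA) => [rA|?]; [left|by right].
exists eps => // s /Ae ->; move: rA => /existsP[q]; rewrite ffunE => Aq.
apply/existsP; exists q; case: (A q) Aq => // J.
by case: ifP.
Qed.

Lemma sched_fast_enough t : fast_enough (sched t).
Proof.
have [T0 idle] := eventually_idle js sched.
have [tT|Tt] := ltP t T0.
  by move=> q J qJ; have := idle t J tT; rewrite (only_enabled Hs qJ).
pose a := T0 - 1.
have aT : a < T0 by rewrite /a; lra.
apply: (@real_induction _ a t (fun t => fast_enough (sched t))).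
- exact: le_trans (ltW aT) Tt.
- by move=> q J qJ; have := idle a J aT; rewrite (only_enabled Hs qJ).
- move=> u _ fu; have [eps eps0 ue] := right_constant Hs u.
  by exists eps => // s /andP[us se]; rewrite ue // (ltW us).
- move=> u /andP[au ut] IH; have [A [eps [eps0 Ae dA]]] := scheduler_step Hs u.
  apply: (dispatch_fast_enough dA) => q J; rewrite ffunE.
  case AqE: (A q) => [X|//]; case: ifP => // _ [XJ]; rewrite -{}XJ.
  pose s := Num.max a (u - eps / 2).
  have as_ : a <= s by rewrite le_max lexx.
  have su : s < u by rewrite gt_max au /=; lra.
  apply: (IH s) => //; first by rewrite as_.
  by rewrite Ae // su andbT lt_max; apply/orP; right; lra.
Qed.

Lemma higher_priority_trans X J' J : hp X J' -> hp J' J -> hp X J.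
Proof.
rewrite /higher_priority => /orP[h1|/andP[/eqP h1 i1]] /orP[h2|/andP[/eqP h2 i2]].
- by rewrite (lt_trans h1 h2).
- by rewrite -h2 h1.
- by rewrite h1 h2.
- by rewrite h1 h2 eqxx (ltn_trans i1 i2) orbT.
Qed.

Lemma deadline_mono i a b : (a <= b)%N ->
  deadline (i, a) + period ts i * (b%:R - a%:R) <= deadline (i, b).
Proof. by move=> ab; rewrite /deadline /= addrAC lerD2r (release_mono js). Qed.

Lemma deadline_lt i a b : (a < b)%N -> deadline (i, a) < deadline (i, b).
Proof.
move=> ab; apply: lt_le_trans (deadline_mono i (ltnW ab)).
by rewrite ltrDl mulr_gt0 ?period_gt0 // subr_gt0 ltr_nat.
Qed.

(** The task index breaks all ties, because jobs of the same task have distinct deadlines. *)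
Lemma higher_priority_total J J' : J != J' -> hp J J' || hp J' J.
Proof.
rewrite /higher_priority; have [//|//|dE] := ltgtP (deadline J) (deadline J') => /=.
case: ltngtP => // iE; rewrite ?orbT //=.
case: J J' dE iE => [i a] [i' b] /= dE /val_inj iE; rewrite -{}iE in dE *.
have [ab|ba|->] := ltngtP a b; last by rewrite eqxx.
- by have := deadline_lt i ab; rewrite dE ltxx.
- by have := deadline_lt i ba; rewrite dE ltxx.
Qed.

Definition precedes J' J : bool := (J' == J) || hp J' J.

Lemma precedes_refl J : precedes J J. Proof. by rewrite /precedes eqxx. Qed.

Lemma precedes_total J J' : precedes J J' || precedes J' J.
Proof.
rewrite /precedes; have [->|JJ'] := eqVneq J J'; first by [].
by rewrite /= higher_priority_total.
Qed.

Lemma precedes_deadline J' J : precedes J' J -> deadline J' <= deadline J.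
Proof.
by case/orP => [/eqP->//|/orP[/ltW//|/andP[/eqP->]]].
Qed.

Lemma not_precedes_deadline J' J : ~~ precedes J' J -> deadline J <= deadline J'.
Proof. by rewrite !negb_or => /and3P[_]; rewrite -leNgt. Qed.

Lemma hp_precedes X J' J : hp X J' -> precedes J' J -> precedes X J.
Proof.
move=> XJ' /orP[/eqP <-|J'J]; apply/orP; right => //.
exact: higher_priority_trans XJ' J'J.
Qed.

Lemma precedes_below i a b J : (a <= b)%N -> precedes (i, b) J -> precedes (i, a) J.
Proof.
rewrite leq_eqVlt => /orP[/eqP->//|ab]; apply: hp_precedes.
by rewrite /higher_priority deadline_lt.
Qed.

Lemma precedes_index J i : exists N, forall j, (j < N)%N = precedes (i, j) J.
Proof.
have ex : exists j, ~~ precedes (i, j) J.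
  have p0 := period_gt0 ts i.
  pose N := Num.bound `|(deadline J - deadline (i, 0)) / period ts i|.
  exists N; apply/negP => /precedes_deadline; apply/negP; rewrite -ltNge.
  apply: lt_le_trans (deadline_mono i (leq0n N)); rewrite subr0.
  rewrite -ltrBlDl mulrC -ltr_pdivrMr //; apply: le_lt_trans (ler_norm _) _.
  exact/archi_boundP.
exists (ex_minn ex) => j; case: ex_minnP => N nN minN; apply/idP/idP.
- by move=> jN; apply: contraLR jN => /minN; rewrite -leqNgt.
- by move=> pj; rewrite ltnNge; apply: contra nN => Nj; apply: precedes_below Nj pj.
Qed.

Lemma arate_busy (S : seq (job n)) A : uniq S ->
  (forall q, exists2 J, J \in S & A q = Some J) -> Rsum pf <= \sum_(J <- S) arate A J.
Proof.
move=> uS busy; rewrite RsumE /arate.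
under [X in _ <= X]eq_bigr do rewrite big_mkcond.
rewrite exchange_big /=; apply: ler_sum => q _.
have [J JS AqJ] := busy q; rewrite (bigD1_seq J) //= AqJ eqxx lerDl.
by apply: sumr_ge0 => X _; case: ifP => // _; exact: speed_ge0.
Qed.

End Dispatch.

(** * Quiet times *)

Section Waiting.
Context {R : realType} {z n : nat} (pf : platform R z) (ts : task_system R n).
Context (js : job_sequence ts) (sched : schedule n pf).
Context (Hs : np_gedf_h js sched).
Local Notation Rs := (Rsum pf).
Local Notation serv := (service js sched).
Local Notation enabled := (enabled js sched).
Local Notation completed := (completed js sched).
Local Notation deadline := (deadline js).
Local Notation precedes := (precedes js).
Local Notation waiting t J := (waiting js sched t (sched t) J).
Local Notation u := (util ts).
Implicit Types (J X : job n) (s t : R) (i : 'I_n.+1) (A : {set 'I_n.+1}).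

Definition rem J t : R := work js J.1 J.2 - serv J t.
Definition lag J t : R := rem J t + u J.1 * (t - deadline J).

Lemma remE J t : rem J t = work js J.1 J.2 - serv J t. Proof. by []. Qed.

Lemma lagE J t : lag J t = rem J t + u J.1 * (t - deadline J). Proof. by []. Qed.

Lemma rem_ge0 J t : 0 <= rem J t.
Proof. by rewrite subr_ge0; exact: serv_le_work. Qed.

Lemma rem_le_cost J t : rem J t <= cost ts J.1.
Proof.
rewrite lerBlDr; apply: le_trans (work_le_cost js _ _) _.
by rewrite lerDl; exact: serv_ge0.
Qed.

Lemma work_le_util i a b : (a < b)%N ->
  work js i b <= u i * (deadline (i, b) - deadline (i, a)).
Proof.
move=> ab; apply: le_trans (work_le_cost js i b) _; rewrite costE.
rewrite ler_pM2l ?util_gt0 // lerBrDl.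
apply: le_trans (deadline_mono js i (ltnW ab)); rewrite lerD2l.
rewrite ler_peMr ?(ltW (period_gt0 _ _)) // lerBrDl.
by rewrite natr1 ler_nat.
Qed.

(** Fluid form of the demand: job [a] is charged what remains of it at [s], and each later job up to
    [b] its utilization times the distance to the previous deadline, which is at least a period. The
    part of [b] still pending at [t] is deducted. *)
Lemma task_service i s t a b M : s <= t ->
  (forall j, (j < a)%N -> completed (i, j) s) -> (a <= b < M)%N ->
  (forall j, (b < j < M)%N -> serv (i, j) t = 0) ->
  \sum_(0 <= j < M) (serv (i, j) t - serv (i, j) s)
    <= rem (i, a) s - rem (i, b) t + u i * (deadline (i, b) - deadline (i, a)).
Proof.
move=> st ca /andP[ab bM] z0; rewrite (big_cat_nat (n := b.+1)) //=.
have -> : \sum_(b.+1 <= j < M) (serv (i, j) t - serv (i, j) s) = 0.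
  rewrite big_nat_cond big1 // => j; rewrite andbT => bj.
  have sj := z0 _ bj; rewrite sj; suff -> : serv (i, j) s = 0 by rewrite subr0.
  by apply/le_anti; rewrite serv_ge0 // andbT -sj serv_mono.
rewrite addr0; clear z0 bM M; elim: b ab => [|b IH] ab.
  move: ab; rewrite leqn0 => /eqP a0; rewrite a0 big_nat1 /rem; lra.
rewrite big_nat_recr //=; move: ab; rewrite leq_eqVlt => /orP[/eqP ab|].
  rewrite ab in ca *; rewrite big_nat_cond big1 ?add0r /rem; first lra.
  move=> j; rewrite andbT => /andP[_ /ca cj].
  have cjt := completed_mono Hs st cj.
  by move: cj cjt; rewrite !completedE // => /eqP -> /eqP ->; rewrite subrr.
rewrite ltnS => ab; have := IH ab; have := rem_ge0 (i, b) t.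
have := serv_ge0 Hs (i, b.+1) s; have := @work_le_util i b b.+1 (ltnSn b).
by rewrite /rem /=; lra.
Qed.

Definition quiet J t : Prop :=
  (forall X, precedes X J -> ~~ waiting t X) /\
  (exists q, forall X, sched t q = Some X -> ~~ precedes X J).

(** An idle processor implies that nothing waits, and it executes no preceding job itself, so it
    would make [t] quiet. *)
Lemma not_quiet_full J t : ~ quiet J t -> forall q, sched t q <> None.
Proof.
move=> nq; have [//|nw] := full_or_no_waiting Hs t.
move=> q qN; apply: nq; split=> [X _|]; first exact: nw.
by exists q => X; rewrite qN.
Qed.

(** If [X] had just started, it would outrank every waiting job; then no preceding job would wait,
    and the processor of [X] would make [t] quiet. *)
Lemma not_quiet_was_running J X t : ~ quiet J t -> ~~ precedes X J ->
  running (sched t) X ->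
  exists2 eps : R, 0 < eps & forall s, t - eps < s < t -> running (sched s) X.
Proof.
move=> nq nX rX; have [//|prio] := started_or_was_running Hs rX.
case: nq; split=> [Y YJ|].
  by apply: contra nX => /prio XY; exact: hp_precedes XY YJ.
by case/existsP: rX => q /eqP qX; exists q => Y; rewrite qX => -[<-].
Qed.

(** The supremum [b] of the quiet times need not be quiet, since preceding jobs may be released
    exactly at [b]; so a quiet [s] is taken within [eta] before it. Non-preceding jobs never start
    at non-quiet times, so those executing after [b] execute at [s] already. *)
Lemma last_quiet J t : exists b, [/\ b <= t,
  forall v, b < v <= t -> ~ quiet J v &
  forall eta : R, 0 < eta -> exists s, [/\ b - eta < s <= b, quiet J s &
    forall X v, b <= v <= t -> ~~ precedes X J -> running (sched v) X ->
      running (sched s) X]].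
Proof.
pose Z := [set v | v <= t /\ quiet J v]%classic.
have [T0 idle] := eventually_idle js sched.
have Z0 : Z (Num.min t (T0 - 1)).
  split; first by rewrite ge_min lexx.
  have nen X : ~~ enabled X (Num.min t (T0 - 1)).
    by apply: idle; rewrite gt_min; apply/orP; right; lra.
  split=> [X _|]; first by rewrite /Defs.waiting (negbTE (nen X)).
  have /card_gt0P[q _] := nprocs_gt0 pf; exists q => X qX.
  by have := nen X; rewrite (only_enabled Hs qX).
have ubZ : ubound Z t by move=> v [].
have supZ : has_sup Z by split; [exists (Num.min t (T0 - 1)) | exists t].
set b := sup Z; have bt : b <= t by apply: ge_sup => //; exists (Num.min t (T0 - 1)).
have nqb v : b < v <= t -> ~ quiet J v.
  move=> /andP[bv vt] qv; have : v <= b by apply: ub_le_sup; [exists t|].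
  by rewrite leNgt bv.
have low X v : b <= v <= t -> ~~ precedes X J -> running (sched v) X -> running (sched b) X.
  move=> /andP[bv vt] nX rX.
  apply: (@real_induction_down _ b v (fun w => running (sched w) X)) => //.
    move=> w /andP[bw wv]; apply: (@not_quiet_was_running J) => //.
    by apply: nqb; rewrite bw (le_trans wv).
  move=> w /andP[bw wv] IH; have [eps eps0 we] := right_constant Hs w.
  pose y := Num.min v (w + eps / 2).
  have wy : w < y by rewrite lt_min wv /=; lra.
  have ye : y < w + eps by rewrite gt_min; apply/orP; right; lra.
  by rewrite -(we y) ?(ltW wy) //; apply: IH; rewrite wy ge_min lexx.
exists b; split=> // eta eta0; have [qb|nqb'] := pselect (quiet J b).
  by exists b; split=> //; rewrite lexx andbT ltrBlDr ltrDl.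
have [A [eps [eps0 Ae]]] := sched_left Hs b.
have [|s [st qs] bs] := sup_adherent (_ : 0 < Num.min eta eps) supZ.
  by rewrite lt_min eta0.
rewrite -/b in bs.
have [me meps] : Num.min eta eps <= eta /\ Num.min eta eps <= eps.
  by rewrite !ge_min !lexx orbT.
have sb : s <= b by apply: ub_le_sup => //; exists t.
have sb' : s < b by rewrite lt_neqAle sb andbT; apply: contra_notN nqb' => /eqP <-.
exists s; split=> //; first by rewrite sb andbT; lra.
move=> X v vb nX /(low X v vb nX) rb.
have [eps' eps'0 re'] := not_quiet_was_running nqb' nX rb.
pose w := b - Num.min eps eps' / 2.
have m0 : 0 < Num.min eps eps' by rewrite lt_min eps0.
have [m1 m2] : Num.min eps eps' <= eps /\ Num.min eps eps' <= eps'.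
  by rewrite !ge_min !lexx orbT.
have : running (sched w) X by apply: re'; rewrite /w; apply/andP; split; lra.
rewrite (Ae w) ?(Ae s) //; rewrite /w; apply/andP; split; lra.
Qed.

Definition running_tasks t : {set 'I_n.+1} :=
  [set i | [exists q, if sched t q is Some X then X.1 == i else false]]%SET.

Lemma eq_running_tasks s t : sched s = sched t -> running_tasks s = running_tasks t.
Proof. by rewrite /running_tasks => ->. Qed.

Lemma running_tasksP t i : reflect (exists j, running (sched t) (i, j)) (i \in running_tasks t).
Proof.
rewrite inE; apply: (iffP existsP) => [[q]|[j /existsP[q /eqP qE]]]; last first.
  by exists q; rewrite qE /=.
case qE: (sched t q) => [[i' j]|//] /= /eqP <-; exists j.
by apply/existsP; exists q; rewrite qE.
Qed.

Lemma card_running_le t (B : {set 'I_n.+1}) (Q : {set proc pf}) :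
  (forall i, i \in B -> exists2 q, q \in Q & exists j, sched t q = Some (i, j)) ->
  (#|B| <= #|Q|)%N.
Proof.
move=> BQ; pose f q := if sched t q is Some X then X.1 else ord0.
suff /subset_leq_card/leq_trans : B \subset [set f q | q in Q]%SET.
  by apply; exact: leq_imset_card.
apply/fintype.subsetP => i /BQ[q qQ [j qE]]; apply/imsetP; exists q => //.
by rewrite /f qE.
Qed.

Lemma card_running_tasks_le t : (#|running_tasks t| <= nprocs pf)%N.
Proof.
rewrite /nprocs -cardsT; apply: (@card_running_le t) => i /running_tasksP[j /existsP[q /eqP qE]].
by exists q; [rewrite inE | exists j].
Qed.

(** Two processors never serve the same task, because at most one of its jobs is enabled. *)
Lemma card_running_tasks_full t : (forall q, sched t q <> None) ->
  #|running_tasks t| = nprocs pf.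
Proof.
move=> full; apply/eqP; rewrite eqn_leq card_running_tasks_le /=.
pose f q := if sched t q is Some X then X.1 else ord0.
have f_inj : injective f.
  move=> q q'; rewrite /f; case qE: (sched t q) (full q) => [[i a]|//] _.
  case qE': (sched t q') (full q') => [[i' a']|//] _ /= ii'; rewrite -{}ii' in qE'.
  have aa' : a = a' := enabled_unique Hs (only_enabled Hs qE) (only_enabled Hs qE').
  by rewrite -aa' in qE'; exact: (one_processor Hs qE qE').
rewrite /nprocs -cardsT -(card_imset _ f_inj); apply: subset_leq_card.
apply/fintype.subsetP => i /imsetP[q _ ->]; rewrite inE; apply/existsP; exists q.
by rewrite /f; case: (sched t q) (full q).
Qed.

(* Otherwise one task more than there are processors would execute at s. *)
Lemma quiet_early J s t : waiting t J -> deadline J <= t -> s <= t -> quiet J s ->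
  (forall X, ~~ precedes X J -> running (sched t) X -> running (sched s) X) ->
  s < deadline J - pmin ts.
Proof.
move=> wJ dt st [qs _] low; rewrite ltNge; apply/negP => ds.
have [eJ nrJ] := andP wJ.
have kN : J.1 \notin running_tasks t.
  apply/running_tasksP => -[j rj]; case/negP: nrJ.
  have -> // : J = (J.1, j).
  rewrite [LHS]surjective_pairing; congr (_, _).
  apply: (enabled_unique Hs (t := t)) (running_enabled Hs rj).
  by rewrite -surjective_pairing.
have pend X : precedes X J -> enabled X t -> X.1 \in running_tasks s.
  move=> XJ eX; have [a [na ca]] := first_uncompleted js sched X.1 s.
  have aX : (a <= X.2)%N.
    rewrite leqNgt; apply/negP => /ca /(completed_mono Hs st).
    by rewrite -surjective_pairing; apply/negP/enabled_not_completed/eX.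
  have aJ : precedes (X.1, a) J by apply: precedes_below aX _; rewrite -surjective_pairing.
  have ea : enabled (X.1, a) s.
    apply/and3P; split=> //=; last by case: (a) ca => // a' ->.
    have := precedes_deadline aJ; have := pmin_le ts X.1.
    have : deadline (X.1, a) = release js X.1 a + period ts X.1 by [].
    lra.
  have := qs _ aJ; rewrite /Defs.waiting ea /= negbK => ra.
  by apply/running_tasksP; exists a.
have : J.1 |: running_tasks t \subset running_tasks s.
  apply/fintype.subsetP => i; rewrite in_setU1 => /orP[/eqP ->|/running_tasksP[j rj]].
    by apply: pend => //; exact: precedes_refl.
  have [pj|nj] := boolP (precedes (i, j) J).
    exact: (pend _ pj (running_enabled Hs rj)).
  by apply/running_tasksP; exists j; exact: low.
move/subset_leq_card; rewrite cardsU1 kN card_running_tasks_full; last exact: (waiting_full Hs wJ).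
by rewrite leqNgt add1n ltnS card_running_tasks_le.
Qed.

End Waiting.

(** * Delay of a waiting job *)

Section Key.
Context {R : realType} {z n : nat} (pf : platform R z) (ts : task_system R n).
Context (js : job_sequence ts) (sched : schedule n pf).
Context (Hs : np_gedf_h js sched).
Context (util_le_alpha : forall i : 'I_n.+1, util ts i <= alpha pf ord_max).
Context (card_Phi_le : forall k : 'I_z.+1, (k < z)%N ->
  (#|Phi pf ts k| <= #|Psi pf k|)%N).
Context (HU : Usum ts <= Rsum pf).

Local Notation Rs := (Rsum pf).
Local Notation serv := (service js sched).
Local Notation enabled := (enabled js sched).
Local Notation completed := (completed js sched).
Local Notation deadline := (deadline js).
Local Notation precedes := (precedes js).
Local Notation waiting t J := (waiting js sched t (sched t) J).
Local Notation u := (util ts).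
Local Notation rem := (rem js sched).
Local Notation lag := (lag js sched).
Local Notation quiet := (quiet js sched).
Implicit Types (J X : job n) (s t : R) (i : 'I_n.+1) (A : {set 'I_n.+1}).

Lemma enabled_ge_first_uncompleted i s t a b : s <= t ->
  (forall j, (j < a)%N -> completed (i, j) s) -> enabled (i, b) t -> (a <= b)%N.
Proof.
move=> st ca eb; rewrite leqNgt; apply/negP => /ca /(completed_mono Hs st).
exact/negP/enabled_not_completed/eb.
Qed.

Lemma first_uncompleted_enabled i t a : ~~ completed (i, a) t ->
  (forall j, (j < a)%N -> completed (i, j) t) -> release js i a <= t -> enabled (i, a) t.
Proof. by move=> na ca rt; apply/and3P; split=> //=; case: (a) ca => // a' ->. Qed.

(* The last line subtracts, when [inA] holds, the fluid demand still pending at t;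
   this is what couples the lateness of J to the lags of the other tasks. *)
Lemma task_service_bound J s t i a N (inA : bool) b :
  s <= t -> s <= deadline J -> quiet J s ->
  (forall X, ~~ precedes X J -> running (sched t) X -> running (sched s) X) ->
  ~~ completed (i, a) s -> (forall j, (j < a)%N -> completed (i, j) s) ->
  (forall j, (j < N)%N = precedes (i, j) J) ->
  (inA -> enabled (i, b) t /\ (precedes (i, b) J || running (sched t) (i, b))) ->
  \sum_(0 <= j < if running (sched s) (i, a) && ~~ precedes (i, a) J then a.+1 else N)
      (serv (i, j) t - serv (i, j) s)
  <= (if running (sched s) (i, a) && precedes (i, a) J then lag (i, a) s else 0)
     + (if running (sched s) (i, a) && ~~ precedes (i, a) J then cost ts i else 0)
     + u i * (deadline J - s)
     - (if inA then rem (i, b) t + u i * (deadline J - deadline (i, b)) else 0).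
Proof.
move=> st sd [qs _] low na ca NE bA.
have u0 := util_gt0 ts i.
have usd : 0 <= u i * (deadline J - s) by rewrite mulr_ge0 ?(ltW u0) // subr_ge0.
have ab : inA -> (a <= b)%N.
  by case/bA => eb _; exact: enabled_ge_first_uncompleted st ca eb.
have low_b : inA -> ~~ precedes (i, b) J -> running (sched s) (i, b).
  by move=> /bA[_ /orP[->//|rb]] nb; exact: low.
have z0 M : inA -> forall j, (b < j < M)%N -> serv (i, j) t = 0.
  move=> /bA[eb _] j /andP[bj _]; apply: (serv_above_uncompleted Hs) bj.
  exact: enabled_not_completed eb.
have dN j : (j < N)%N -> deadline (i, j) <= deadline J.
  by rewrite NE => /precedes_deadline.
have through_last : (a < N)%N -> exists l, [/\ (a <= l < N)%N, deadline (i, l) <= deadline J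
   & \sum_(0 <= j < N) (serv (i, j) t - serv (i, j) s)
     <= rem (i, a) s + u i * (deadline (i, l) - deadline (i, a))].
  case: N {z0} NE dN => // N NE dN; rewrite ltnS => aN; exists N; rewrite aN ltnSn.
  split=> //; first exact: dN.
  have := task_service (M := N.+1) Hs st ca (_ : a <= N < N.+1)%N.
  rewrite aN ltnSn => /(_ isT); have := rem_ge0 Hs (i, N) t => h1 h2.
  by apply: le_trans (h2 _) _; [move=> j; rewrite ltnS; case: ltngtP | lra].
have [ra|nra] := boolP (running (sched s) (i, a)); have [pa|npa] := boolP (precedes (i, a) J) => /=.
(* A preceding job executes at [s]: its lag and the fluid term pay for it and for the later
   preceding jobs of the task. *)
- have aN : (a < N)%N by rewrite NE.
  case: (boolP inA) => [iA|_]; last first.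
    have [l [_ dl h]] := through_last aN; apply: le_trans h _.
    have : 0 <= u i * (deadline J - deadline (i, l)) by rewrite mulr_ge0 ?(ltW u0) // subr_ge0.
    by rewrite lagE /=; lra.
  have [pb|nb] := boolP (precedes (i, b) J); last first.
    have ba := enabled_unique Hs (running_enabled Hs (low_b iA nb)) (running_enabled Hs ra).
    by rewrite ba pa in nb.
  have abN : (a <= b < N)%N by rewrite ab // NE.
  apply: le_trans (task_service Hs st ca abN (z0 N iA)) _.
  by rewrite lagE /=; lra.
(* A non-preceding job executes at [s]: all earlier jobs are complete, and it is charged its full
   cost. *)
- have rc := rem_le_cost Hs (i, a) s.
  have aa : (a <= a < a.+1)%N by rewrite leqnn ltnSn.
  have h := task_service (M := a.+1) Hs st ca aa.
  have {}h := h _; apply: le_trans (h _) _.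
    by move=> j; rewrite ltnS; case: ltngtP.
  have ra0 := rem_ge0 Hs (i, a) t.
  case: (boolP inA) => [iA|_]; last by rewrite /= in rc; lra.
  have npb : ~~ precedes (i, b) J.
    by apply: contra npa; exact: precedes_below (ab iA).
  have ba := enabled_unique Hs (running_enabled Hs (low_b iA npb)) (running_enabled Hs ra).
  have : 0 <= u i * (deadline (i, a) - s).
    by rewrite mulr_ge0 ?(ltW u0) // subr_ge0 (le_trans sd) // not_precedes_deadline.
  by rewrite ba /=; rewrite /= in rc; lra.
(* Job [a] precedes [J] without executing; as [s] is quiet it does not wait either, so it is not yet
   released and the fluid term from [s] on covers all demand. *)
- have aN : (a < N)%N by rewrite NE.
  have sr : s < release js i a.
    rewrite ltNge; apply/negP => /(first_uncompleted_enabled na ca) ea.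
    by have := qs _ pa; rewrite /Defs.waiting ea nra.
  have da : u i * deadline (i, a) = u i * release js i a + u i * period ts i.
    by rewrite -mulrDr.
  have rc := rem_le_cost Hs (i, a) s; rewrite costE /= in rc.
  have : u i * s <= u i * release js i a by rewrite ler_pM2l // ltW.
  move=> usr.
  case: (boolP inA) => [iA|_]; last first.
    have [l [_ dl h]] := through_last aN; apply: le_trans h _.
    have : 0 <= u i * (deadline J - deadline (i, l)) by rewrite mulr_ge0 ?(ltW u0) // subr_ge0.
    by lra.
  have [pb|nb] := boolP (precedes (i, b) J); last first.
    have := running_enabled Hs (low_b iA nb) => eb.
    have ba : b = a.
      apply/eqP; rewrite eqn_leq ab // andbT leqNgt; apply/negP => ab'.
      by case/negP: na; exact: (enabled_below_completed Hs ab').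
    by rewrite ba pa in nb.
  have abN : (a <= b < N)%N by rewrite ab // NE.
  apply: le_trans (task_service Hs st ca abN (z0 N iA)) _.
  by lra.
(* All jobs of the task that precede [J] are complete at [s]. *)
- have Na : (N <= a)%N by rewrite leqNgt NE.
  rewrite big_nat_cond big1; last first.
    move=> j; rewrite andbT => /andP[_ jN]; have cj := ca j (leq_trans jN Na).
    by move: cj (completed_mono Hs st cj); rewrite !completedE // => /eqP -> /eqP ->; rewrite subrr.
  case: (boolP inA) => [iA|_]; last by rewrite !add0r subr0.
  have npb : ~~ precedes (i, b) J.
    by apply: contra npa; exact: precedes_below (ab iA).
  have eb := running_enabled Hs (low_b iA npb).
  have ba : b = a.
    apply/eqP; rewrite eqn_leq ab // andbT leqNgt; apply/negP => ab'.
    by case/negP: na; exact: (enabled_below_completed Hs ab').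
  by move: (low_b iA npb); rewrite ba (negbTE nra).
Qed.

Definition lag_bounded s : Prop := forall A (jb : 'I_n.+1 -> nat),
  (#|A| <= (nprocs pf).-1)%N -> (forall i, i \in A -> running (sched s) (i, jb i)) ->
  \sum_(i in A) lag (i, jb i) s <= lag_bound pf ts A.

(** After [b] the whole platform serves preceding jobs and jobs already executing at [s]. Set
    against the summed task bounds, the fluid demand up to the deadline is absorbed by
    [Usum <= Rsum], and what was executing at [s] by [lag_bound_le]. *)
Lemma waiting_bound J t A (jb : 'I_n.+1 -> nat) :
  waiting t J -> deadline J <= t -> (forall s, s <= t - pmin ts -> lag_bounded s) ->
  J.1 \in A -> jb J.1 = J.2 ->
  (forall i, i \in A -> enabled (i, jb i) t /\
     (precedes (i, jb i) J || running (sched t) (i, jb i))) ->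
  Rs * (t - deadline J)
    + \sum_(i in A) (rem (i, jb i) t + u i * (deadline J - deadline (i, jb i)))
    <= Gbound pf ts.
Proof.
move=> wJ dt IH JA jbJ hA; have Rs0 : 0 <= Rs by apply: le_trans ler01 (Rsum_ge1 pf).
have [b [bt nq near]] := last_quiet Hs J t.
apply: (@le_of_lt_add_eps _ _ _ Rs Rs0) => eta /near[s [/andP[bs sb] qs low]].
have st := le_trans sb bt.
have lowt X : ~~ precedes X J -> running (sched t) X -> running (sched s) X.
  by apply: low; rewrite bt lexx.
have sd := quiet_early Hs wJ dt st qs lowt.
have P0 := pmin_gt0 ts.
have sd' : s <= deadline J by lra.
have [a Ha] := choice (fun i => first_uncompleted js sched i s).
have [N HN] := choice (fun i => precedes_index js J i).
pose run i := running (sched s) (i, a i); pose prec i := precedes (i, a i) J.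
(* The jobs of index below [M i] include every job of the task that executes between [b] and [t]; a
   non-preceding one can only be the job [a i] executing at [s]. *)
pose M i := if run i && ~~ prec i then (a i).+1 else N i.
have per_task i := task_service_bound st sd' qs lowt (Ha i).1 (Ha i).2 (HN i) (hA i).
pose S := [seq (i, j) | i <- enum 'I_n.+1, j <- iota 0 (M i)].
have SE (F : job n -> R) : \sum_(J <- S) F J = \sum_i \sum_(0 <= j < M i) F (i, j).
  rewrite /S big_allpairs_dep big_enum /=.
  by apply: eq_bigr => i _; rewrite /index_iota subn0.
have uS : uniq S.
  apply: allpairs_uniq_dep; [exact: enum_uniq | by move=> i _; exact: iota_uniq |].
  by move=> [i j] [i' j'] _ _ /= [-> ->].
have busy : Rs * (t - b) <= \sum_(J <- S) (serv J t - serv J b).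
  apply: (serv_lower Hs bt) => v /andP[bv vt]; apply: arate_busy => // q.
  have nqv : ~ quiet J v by apply: nq; rewrite bv ltW.
  have := not_quiet_full Hs nqv (q := q).
  case qE: (sched v q) => [[i j]|//] _; exists (i, j) => //.
  apply/allpairsPdep; exists i, j; rewrite mem_enum mem_iota /= add0n; split=> //.
  have rij : running (sched v) (i, j) by apply/existsP; exists q; rewrite qE.
  rewrite /M; have [pij|nij] := boolP (precedes (i, j) J).
    have jN : (j < N i)%N by rewrite HN.
    case: ifP => // /andP[_ npi]; rewrite ltnS ltnW // (leq_trans jN) //.
    by rewrite leqNgt HN.
  have rs : running (sched s) (i, j) by apply: (low _ v) => //; rewrite (ltW bv) (ltW vt).
  have ja : j = a i.
    have es := running_enabled Hs rs.
    apply/eqP; rewrite eqn_leq (enabled_ge_first_uncompleted (lexx s) (Ha i).2 es) andbT.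
    rewrite leqNgt; apply/negP => /(enabled_below_completed Hs) /(_ es).
    exact/negP/(Ha i).1.
  by rewrite /run /prec -ja rs nij.
have served : \sum_(J <- S) (serv J t - serv J b) <= \sum_(J <- S) (serv J t - serv J s).
  by apply: ler_sum => X _; rewrite lerD2l lerN2 serv_mono.
have := le_trans busy served; rewrite SE => {}busy.
have {per_task} main := le_trans busy (ler_sum _ (fun i _ => per_task i)).
rewrite sumrB 2!big_split /= -3!big_mkcond /= -mulr_suml in main.
pose psi := [set i | run i && prec i]%SET.
pose lo := [set i | run i && ~~ prec i]%SET.
have run_task i : run i -> exists q, sched s q = Some (i, a i).
  by case/existsP => q /eqP; exists q.
have cpsi : (#|psi| <= (nprocs pf).-1)%N.
  have [_ [q0 q0J]] := qs; apply: (@leq_trans #|[set: proc pf] :\ q0|); last first.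
    by rewrite /nprocs -cardsT [X in (_ <= X.-1)%N](cardsD1 q0) inE.
  apply: (@card_running_le _ _ _ _ sched s) => i; rewrite inE => /andP[/run_task[q qE] pi].
  exists q; last by exists (a i).
  by rewrite !inE andbT; apply: contraTneq pi => qq; apply: q0J; rewrite -qq.
have cB : (#|psi :|: lo| <= nprocs pf)%N.
  rewrite /nprocs -cardsT; apply: (@card_running_le _ _ _ _ sched s) => i.
  rewrite !inE -andb_orr orbN andbT => /run_task[q qE].
  by exists q; rewrite ?inE //; exists (a i).
have lag_psi : \sum_(i | run i && prec i) lag (i, a i) s <= lag_bound pf ts psi.
  rewrite (eq_bigl (fun i => i \in psi)); last by move=> i; rewrite inE.
  apply: IH => //; first by lra.
  by move=> i; rewrite inE => /andP[].
have GB := lag_bound_le util_le_alpha card_Phi_le (finset.subsetUl psi lo) cpsi cB.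
have costB : total_cost ts (psi :|: lo)
    = total_cost ts psi + \sum_(i | run i && ~~ prec i) cost ts i.
  rewrite /total_cost (bigID prec) /=; congr (_ + _); apply: eq_bigl => i.
    by rewrite !inE; case: (run i); case: (prec i).
  by rewrite !inE; case: (run i); case: (prec i).
rewrite costB in GB; rewrite /lag_bound in lag_psi.
have HUd : Usum ts * (deadline J - s) <= Rs * (deadline J - s).
  by rewrite ler_wpM2r // subr_ge0.
have Rsb : Rs * (b - s) <= Rs * eta by rewrite ler_wpM2l //; lra.
rewrite -/(Usum ts) in main.
by lra.
Qed.

End Key.

(** * Lags of simultaneously executing tasks *)

Lemma exists_max_seq (T : eqType) (r : rel T) (s : seq T) :
  total r -> transitive r -> s != [::] -> exists2 x, x \in s & forall y, y \in s -> r y x.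
Proof.
move=> tot tr; elim: s => // x s IH _; have [s0|/IH[m ms mmax]] := eqVneq s [::].
  exists x; first by rewrite mem_head.
  by move=> y; rewrite s0 mem_seq1 => /eqP ->; have := tot x x; rewrite orbb.
have [xm|mx] := orP (tot x m).
  exists m; first by rewrite in_cons ms orbT.
  by move=> y; rewrite in_cons => /orP[/eqP->|/mmax].
exists x; first by rewrite mem_head.
move=> y; rewrite in_cons => /orP[/eqP->|/mmax ym]; last exact: tr ym mx.
by have := tot x x; rewrite orbb.
Qed.

Section LagBounded.
Context {R : realType} {z n : nat} (pf : platform R z) (ts : task_system R n).
Context (js : job_sequence ts) (sched : schedule n pf).
Context (Hs : np_gedf_h js sched).
Context (util_le_alpha : forall i : 'I_n.+1, util ts i <= alpha pf ord_max).
Context (card_Phi_le : forall k : 'I_z.+1, (k < z)%N ->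
  (#|Phi pf ts k| <= #|Psi pf k|)%N).
Context (HU : Usum ts <= Rsum pf).

Local Notation Rs := (Rsum pf).
Local Notation serv := (service js sched).
Local Notation enabled := (enabled js sched).
Local Notation completed := (completed js sched).
Local Notation deadline := (deadline js).
Local Notation precedes := (precedes js).
Local Notation waiting t J := (waiting js sched t (sched t) J).
Local Notation u := (util ts).
Local Notation rem := (rem js sched).
Local Notation lag := (lag js sched).
Local Notation running_tasks := (running_tasks sched).
Local Notation F := (lag_bound pf ts).
Local Notation G := (Gbound pf ts).
Implicit Types (J X : job n) (s t : R) (i : 'I_n.+1) (A : {set 'I_n.+1}).

(** By [sched_fast_enough] the task is served at least at the rate of its utilization, and
    [task_service] carries the comparison across completions of its jobs. *)
Lemma lag_nonincreasing i s t a b : s <= t ->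
  running (sched s) (i, a) -> running (sched t) (i, b) ->
  (forall v, s < v < t -> i \in running_tasks v) ->
  lag (i, b) t <= lag (i, a) s.
Proof.
move=> st ra rb cont; have ea := running_enabled Hs ra; have eb := running_enabled Hs rb.
have ca j : (j < a)%N -> completed (i, j) s.
  by move=> ja; exact: (enabled_below_completed Hs ja).
have ab := enabled_ge_first_uncompleted Hs st ca eb.
pose S := [seq (i, j) | j <- iota 0 b.+1].
have SE (f : job n -> R) : \sum_(J <- S) f J = \sum_(0 <= j < b.+1) f (i, j).
  by rewrite big_map /index_iota subn0.
have low : u i * (t - s) <= \sum_(J <- S) (serv J t - serv J s).
  apply: (serv_lower Hs st) => v /andP[sv vt].
  have /running_tasksP[j rj] := cont v (introT andP (conj sv vt)).
  have jb : (j <= b)%N.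
    rewrite leqNgt; apply/negP => bj; have ej := running_enabled Hs rj.
    have := completed_mono Hs (ltW vt) (enabled_below_completed Hs bj ej).
    exact/negP/(enabled_not_completed eb).
  have jS : (i, j) \in S by apply: map_f; rewrite mem_iota /= add0n ltnS.
  have uS : uniq S by rewrite map_inj_uniq ?iota_uniq // => j1 j2 [].
  rewrite (bigD1_seq (i, j)) //= ler_wpDr //.
    by apply: sumr_ge0 => X _; exact: arate_ge0.
  case/existsP: (rj) => q qE; rewrite /rate (bigD1 q) //= ler_wpDr //.
    by apply: sumr_ge0 => q' _; exact: speed_ge0.
  by have /eqP/(sched_fast_enough Hs) := qE.
have abb : (a <= b < b.+1)%N by rewrite ab ltnSn.
have := task_service Hs st ca abb; rewrite SE in low => h.
have {}h := h _; rewrite !lagE /=.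
have {h} : u i * (t - s) <= rem (i, a) s - rem (i, b) t
    + u i * (deadline (i, b) - deadline (i, a)).
  by apply: le_trans low (h _) => j; rewrite ltnS; case: ltngtP.
lra.
Qed.

Lemma total_util_lt A : (#|A| <= (nprocs pf).-1)%N -> 0 < Rs - total_util ts A.
Proof.
move=> cA; have := sum_util_le util_le_alpha card_Phi_le cA.
by rewrite -/(total_util ts A); lra.
Qed.

(** By [lag_bound_setD1], [F A] is at least a weighted mean of the left-hand side and [G], and
    [lag_bound_le] shows that the left-hand side is at most [G]. *)
Lemma lag_bound_setD1_le A i : i \in A -> (#|A| <= (nprocs pf).-1)%N ->
  F (A :\ i) + cost ts i <= F A.
Proof.
move=> iA cA; have D0 := total_util_lt cA; have u0 := util_gt0 ts i.
have UR : total_util ts A <= Rs by lra.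
have h := lag_bound_setD1 (pf := pf) iA UR.
have cA1 : (#|A :\ i| <= (nprocs pf).-1)%N.
  by apply: leq_trans cA; rewrite (cardsD1 i A) leq_addl.
have := lag_bound_le util_le_alpha card_Phi_le (finset.subD1set A i) cA1
  (leq_trans cA (leq_pred _)).
rewrite (_ : total_cost ts A = total_cost ts (A :\ i) + cost ts i); last first.
  by rewrite /total_cost (big_setD1 i) //= addrC.
rewrite addrAC -/(F (A :\ i)) => FG.
have D1 : 0 < Rs - total_util ts A + u i by lra.
rewrite -(ler_pM2l D1); apply: le_trans h; rewrite mulrDl lerD2l.
by rewrite ler_pM2l.
Qed.

Lemma lag_bounded_step t : (forall s, s <= t - pmin ts -> lag_bounded js sched s) ->
  forall s, s <= t -> lag_bounded js sched s.
Proof.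
move=> IH s0 s0t A; move: {2}#|A| (leqnn #|A|) s0 s0t => k; elim: k A => [|k IHk] A Ak s st jb cA run.
  have -> : A = finset.set0 by apply/eqP; rewrite -cards_eq0 -leqn0.
  by rewrite big_set0 /lag_bound /total_cost /total_util !big_set0 !mul0r addr0.
have [->|A0] := eqVneq A finset.set0.
  by rewrite big_set0 /lag_bound /total_cost /total_util !big_set0 !mul0r addr0.
have [T0 idle] := eventually_idle js sched.
pose Z := [set v | v <= s /\ ~ A \subset running_tasks v]%classic.
have Z0 : Z (Num.min s (T0 - 1)).
  split; first by rewrite ge_min lexx.
  have [i iA] := set0Pn _ A0; move/fintype.subsetP/(_ i iA)/running_tasksP => [j /(running_enabled Hs)].
  by apply/negP/idle; rewrite gt_min; apply/orP; right; lra.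
have supZ : has_sup Z by split; [exists (Num.min s (T0 - 1)) | exists s => v []].
(* From [sg] to [s] all tasks of [A] execute without interruption, so their lags need to be bounded
   at [sg] only. *)
set sg := sup Z; have sgs : sg <= s.
  by apply: ge_sup; [exists (Num.min s (T0 - 1)) | move=> v []].
have after v : sg < v <= s -> A \subset running_tasks v.
  case/andP=> sv vs; apply: contrapT => nv; have : v <= sg.
    by apply: ub_le_sup; [exists s => w [] | split].
  by rewrite leNgt sv.
have runs : A \subset running_tasks s.
  by apply/fintype.subsetP => i iA; apply/running_tasksP; exists (jb i); exact: run.
have runsg : A \subset running_tasks sg.
  have [->//|sgs'] := eqVneq sg s; have [eps eps0 we] := right_constant Hs sg.
  have ltsg : sg < s by rewrite lt_neqAle sgs' sgs.
  pose y := Num.min s (sg + eps / 2).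
  have sy : sg < y by rewrite lt_min ltsg /=; lra.
  have ye : y < sg + eps by rewrite gt_min; apply/orP; right; lra.
  rewrite -(@eq_running_tasks _ _ _ _ sched y); last by rewrite we ?(ltW sy).
  by apply: after; rewrite sy ge_min lexx.
have [A0' [eps [eps0 left]]] := sched_left Hs sg.
have [z0 [z0s nz0] sgz0] := sup_adherent eps0 supZ; rewrite -/sg in sgz0.
have z0sg : z0 < sg.
  rewrite lt_neqAle ub_le_sup ?andbT; [|by exists s => w []|by split].
  by apply/eqP => z0E; apply: nz0; rewrite z0E.
have rtE v : sg - eps < v < sg -> running_tasks v = running_tasks z0.
  by move=> ve; apply: eq_running_tasks; rewrite !left // sgz0.
(* The tasks of [A] that start at [sg]: the assignment of [z0] is in force throughout a left
   neighbourhood of [sg]. *)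
pose C := A :\: running_tasks z0.
have [i0 i0C] : exists i, i \in C.
  by apply/set0Pn; apply: contra_notN nz0; rewrite finset.setD_eq0.
have CA i : i \in C -> i \in A by rewrite inE => /andP[].
have [jg Hjg] : {jg : 'I_n.+1 -> nat & forall i, i \in A -> running (sched sg) (i, jg i)}.
  apply: (@choice _ _ (fun i j => i \in A -> running (sched sg) (i, j))) => i.
  have [/(fintype.subsetP runsg)/running_tasksP[j rj]|niA] := boolP (i \in A).
    by exists j.
  by exists 0%N.
apply: le_trans (_ : \sum_(i in A) lag (i, jg i) sg <= _).
  apply: ler_sum => i iA; apply: lag_nonincreasing => //; [exact: Hjg | exact: run |].
  by move=> v /andP[sv vs]; apply: (fintype.subsetP (after v _)) => //; rewrite sv ltW.
have sgt := le_trans sgs st.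
have cD1 i : i \in A -> (#|A :\ i| <= k)%N /\ (#|A :\ i| <= (nprocs pf).-1)%N.
  move=> iA; split.
    by rewrite -ltnS; apply: leq_trans Ak; rewrite (cardsD1 i A) iA.
  by apply: leq_trans cA; rewrite (cardsD1 i A) leq_addl.
have IHD1 i : i \in A -> \sum_(j in A :\ i) lag (j, jg j) sg <= F (A :\ i).
  move=> iA; have [c1 c2] := cD1 i iA; apply: IHk => // j; rewrite !inE => /andP[_].
  exact: Hjg.
(* A task that is not late at [sg] has lag at most its cost, and the induction on cardinality
   suffices. *)
have [/exists_inP[i iC di]|/exists_inPn late] := boolP [exists i in C, sg <= deadline (i, jg i)].
  have iA := CA i iC; apply: le_trans (lag_bound_setD1_le iA cA).
  rewrite (big_setD1 i) //= addrC; apply: lerD; first exact: IHD1.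
  have := rem_le_cost Hs (i, jg i) sg.
  have : 0 <= u i * (deadline (i, jg i) - sg) by rewrite mulr_ge0 ?subr_ge0 // ltW ?util_gt0.
  by rewrite lagE /=; lra.
have {}late i : i \in C -> deadline (i, jg i) < sg by move=> /late; rewrite -ltNge.
have [i iC imax] : exists2 i, i \in C & forall j, j \in C -> precedes (j, jg j) (i, jg i).
  pose r (i j : 'I_n.+1) := precedes (i, jg i) (j, jg j).
  have tot : total r by move=> j l; exact: precedes_total.
  have tr : transitive r.
    move=> j i l; rewrite /r => /orP[/eqP -> //|]; exact: hp_precedes.
  have C0 : enum C != [::].
    by apply: contraTneq i0C => C0; rewrite -mem_enum C0.
  have [i] := exists_max_seq tot tr C0; rewrite mem_enum => iC imax.
  by exists i => // j jC; apply: imax; rewrite mem_enum.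
have iA := CA i iC; set J := (i, jg i) in imax; set d := deadline J.
have dsg : d < sg by exact: late.
have [jz Hjz] : {jz : 'I_n.+1 -> nat & forall i, i \in A -> i \notin C -> running (sched z0) (i, jz i)}.
  apply: (@choice _ _ (fun i j => i \in A -> i \notin C -> running (sched z0) (i, j))) => j.
  have [/andP[jA]|nj] := boolP ((j \in A) && (j \notin C)).
    by rewrite inE jA andbT negbK => /running_tasksP[l rl]; exists l.
  by exists 0%N => jA njC; rewrite jA njC in nj.
(* Just before [sg] a task of [C] waits with the job that it starts at [sg], whereas another task of
   [A] executes, possibly an earlier job than at [sg]. *)
pose jb' j := if j \in C then jg j else jz j.
have T_le : Rs * (sg - d) + \sum_(j in A) lag (j, jg j) sg - total_util ts A * (sg - d) <= G.
  have Rs0 : 0 <= Rs by apply: le_trans ler01 (Rsum_ge1 pf).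
  apply: (@le_of_lt_add_eps _ _ _ Rs Rs0) => eta eta0.
  pose dC := \big[Num.max/d]_(j in C) deadline (j, jg j).
  have dCsg : dC < sg by apply/bigmax_ltP; split=> // j /late.
  (* The time [v] is so close to [sg] that the assignment is constant from [v] to [sg], and past the
     deadlines of [C], so that all its jobs are released and wait. *)
  pose v := Num.max dC (sg - Num.min eta (eps / 2)).
  have m0 : 0 < Num.min eta (eps / 2) by rewrite lt_min eta0 divr_gt0.
  have [m1 m2] : Num.min eta (eps / 2) <= eta /\ Num.min eta (eps / 2) <= eps / 2.
    by rewrite !ge_min !lexx orbT.
  have vsg : v < sg by rewrite gt_max dCsg /=; lra.
  have vm : sg - Num.min eta (eps / 2) <= v by rewrite le_max lexx orbT.
  have dCv : dC <= v by rewrite le_max lexx.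
  have dv : d <= v by apply: le_trans dCv; exact: bigmax_ge_id.
  have ve : sg - eps < v < sg by rewrite vsg andbT; lra.
  have sched_v w : v <= w < sg -> sched w = sched z0.
    move=> /andP[vw wsg]; rewrite !left ?sgz0 // wsg andbT.
    by case/andP: ve => ve _; exact: lt_le_trans ve vw.
  have not_run j l w : j \in C -> v <= w < sg -> ~~ running (sched w) (j, l).
    move=> jC /sched_v ->; apply: contraL jC => rj; rewrite inE negb_and negbK.
    by apply/orP; left; apply/running_tasksP; exists l.
  have serv_v j l : j \in C -> serv (j, l) sg = serv (j, l) v.
    move=> jC; apply: (serv_const Hs (ltW vsg)) => w /andP[vw wsg].
    by apply: not_run; rewrite // (ltW vw).
  have wait_v j : j \in C -> waiting v (j, jg j).
    move=> jC; rewrite /Defs.waiting not_run ?lexx ?vsg // andbT.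
    have /and3P[_ nc pc] := running_enabled Hs (Hjg j (CA j jC)).
    apply/and3P; split => /=.
    - have : deadline (j, jg j) <= v by apply: le_trans dCv; exact: le_bigmax_cond.
      have : deadline (j, jg j) = release js j (jg j) + period ts j by [].
      have := period_gt0 ts j; lra.
    - by apply: contra nc; exact: completed_mono (ltW vsg).
    - by move: pc; case: (jg j) => //= l; rewrite /Defs.completed serv_v.
  have vt : v <= t by apply: le_trans (ltW vsg) sgt.
  have := waiting_bound (A := A) (jb := jb') Hs util_le_alpha card_Phi_le HU (wait_v i iC) dv _ iA.
  have jb'i : jb' i = jg i by rewrite /jb' iC.
  rewrite -/J -/d => /(_ _ jb'i) h.
  apply: le_trans (_ : (G + Rs * (sg - v)) <= _); last by rewrite lerD2l ler_wpM2l //; lra.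
  rewrite -lerBlDr; apply: le_trans (h _ _).
  - have -> : total_util ts A * (sg - d) = \sum_(j in A) u j * (sg - d) by rewrite mulr_suml.
    have -> : forall x y w : R, x + y - w - Rs * (sg - v) = (x - Rs * (sg - v)) + (y - w).
      by move=> *; lra.
    rewrite -sumrB; apply: lerD; first by lra.
    apply: ler_sum => j jA; rewrite /jb'; have [jC|njC] := boolP (j \in C).
      by rewrite !lagE !remE serv_v //=; lra.
    have : lag (j, jg j) sg <= lag (j, jz j) v.
      apply: lag_nonincreasing; [exact: ltW | | exact: Hjg |].
        by rewrite sched_v ?lexx //; exact: Hjz.
      move=> w /andP[vw wsg]; apply/running_tasksP; exists (jz j).
      by rewrite sched_v ?wsg ?(ltW vw) //; exact: Hjz.
    have : 0 <= u j * (sg - v) by rewrite mulr_ge0 ?subr_ge0 ?(ltW vsg) ?(ltW (util_gt0 ts j)).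
    by rewrite [lag (j, jz j) v]lagE /=; lra.
  - by move=> w wv; apply: IH; apply: le_trans wv _; rewrite lerD2r.
  - move=> j jA; rewrite /jb'; have [jC|njC] := boolP (j \in C).
      by split; [case/andP: (wait_v j jC) | rewrite imax].
    have rj : running (sched v) (j, jz j) by rewrite sched_v ?lexx ?vsg //; exact: Hjz.
    by split; [exact: (running_enabled Hs rj) | rewrite rj orbT].
have D0 := total_util_lt cA; have u0 := util_gt0 ts i.
have D1 : 0 < Rs - total_util ts A + u i by lra.
rewrite -(ler_pM2l D1).
have UR : total_util ts A <= Rs by lra.
apply: le_trans (lag_bound_setD1 (pf := pf) iA UR).
set T := \sum_(j in A) _ in T_le *.
have T_le' : T <= F (A :\ i) + cost ts i + u i * (sg - d).
  rewrite /T (big_setD1 i) //=; have := IHD1 i iA; have := rem_le_cost Hs J sg.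
  by rewrite lagE -/J -/d /=; lra.
(* With weights [Rs - total_util ts A] and [util ts i], the lateness [sg - d] cancels from the two
   bounds on [T]. *)
have h1 : (Rs - total_util ts A) * T <=
    (Rs - total_util ts A) * (F (A :\ i) + cost ts i + u i * (sg - d)).
  by rewrite ler_pM2l.
have h2 : u i * (T + (Rs - total_util ts A) * (sg - d)) <= u i * G.
  by rewrite ler_pM2l //; lra.
lra.
Qed.

Lemma lag_bounded_all t : lag_bounded js sched t.
Proof.
have [T0 idle] := eventually_idle js sched; have P0 := pmin_gt0 ts.
suff H k : forall s, s <= T0 - 1 + k%:R * pmin ts -> lag_bounded js sched s.
  apply: (H (Num.bound `|(t - (T0 - 1)) / pmin ts|)).
  rewrite -lerBlDl -ler_pdivrMr //; apply: le_trans (ler_norm _) _.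
  exact/ltW/archi_boundP.
elim: k => [s|k IH].
  rewrite mul0r addr0 => sT A jb _ run.
  have -> : A = finset.set0.
    apply/setP => i; rewrite inE; apply/negP => /run/(running_enabled Hs); apply/negP/idle.
    lra.
  by rewrite big_set0 /lag_bound /total_cost /total_util !big_set0 !mul0r addr0.
apply: lag_bounded_step => s sT; apply: IH; apply: le_trans sT _.
by rewrite -natr1; lra.
Qed.

End LagBounded.

(** * Response times *)

Section ResponseTime.
Context {R : realType} {z n : nat} (pf : platform R z) (ts : task_system R n).
Context (js : job_sequence ts) (sched : schedule n pf).
Context (Hs : np_gedf_h js sched).
Context (util_le_alpha : forall i : 'I_n.+1, util ts i <= alpha pf ord_max).
Context (card_Phi_le : forall k : 'I_z.+1, (k < z)%N ->
  (#|Phi pf ts k| <= #|Psi pf k|)%N).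
Context (HU : Usum ts <= Rsum pf).

Local Notation Rs := (Rsum pf).
Local Notation x := (xbound pf ts).

Lemma rem_waiting_le i j t : waiting js sched t (sched t) (i, j) ->
  deadline js (i, j) <= t ->
  rem js sched (i, j) t <= Gbound pf ts - Rs * (t - deadline js (i, j)).
Proof.
move=> wJ dt; have := @waiting_bound _ _ _ _ _ _ _ Hs util_le_alpha card_Phi_le HU
  (i, j) t [set i]%SET (fun=> j) wJ dt.
rewrite big_set1 subrr mulr0 addr0 => h; rewrite lerBrDl; apply: h => //.
- by move=> s _; exact: lag_bounded_all.
- by rewrite inE.
- move=> k; rewrite inE => /eqP ->; split; last by rewrite precedes_refl.
  by case/andP: wJ.
Qed.

(** From [t0] on the remaining work stays below the line [mu * (tau - t)], which vanishes at [tau].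
    While the job executes, its speed is at least [mu]. While it waits, the delay bound is at most
    [Rs * (t0 - t) + e] by [Gbound_le]; this meets the line at [t0] and falls at least as fast,
    since [mu <= Rs]. *)
Lemma completed_by_of_pred i j :
  (forall t, release js i j + x + period ts i <= t ->
     if j is l.+1 then completed js sched (i, l) t else true) ->
  completed js sched (i, j) (release js i j + (x + 2 * period ts i)).
Proof.
set r := release js i j; set p := period ts i; set e := cost ts i; set tau := r + (_ + _).
move=> pred_done.
have p0 : 0 < p := period_gt0 ts i; have e0 : 0 < e := cost_gt0 ts i.
have u0 := util_gt0 ts i; have x0 := xbound_ge0 pf ts; have Rs1 := Rsum_ge1 pf.
(* A lower bound for the speed of any processor executing the task; [e / mu] thus bounds its
   execution time, and [t0] leaves just that much time before [tau]. *)
pose mu := Num.max 1 (util ts i).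
have mu1 : 1 <= mu by rewrite le_max lexx.
have mu0 : 0 < mu by exact: lt_le_trans ltr01 mu1.
have muR : mu <= Rs.
  by rewrite ge_max Rs1 (le_trans (util_le_alpha i)) // alpha_le_Rsum.
have emu : mu * (e / mu) = e by rewrite mulrC divfK // gt_eqF.
have emu0 : 0 <= e / mu by rewrite divr_ge0 // ltW.
have emu_e : e / mu <= e by rewrite ler_pdivrMr // ler_peMr // ltW.
have emu_p : e / mu <= p.
  by rewrite ler_pdivrMr // /e costE mulrC ler_pM2l // le_max lexx orbT.
set em := e / mu in emu emu0 emu_e emu_p.
pose t0 := tau - em.
have t0tau : t0 <= tau by rewrite lerBlDr lerDl.
have t0E : t0 = r + p + x + (p - em) by rewrite /t0 /tau; lra.
have dE : deadline js (i, j) = r + p by [].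
have [//|nc] := boolP (completed js sched (i, j) tau).
have en t : t0 <= t -> t <= tau -> enabled js sched (i, j) t.
  move=> t0t ttau; apply/and3P; split => /=.
  - by rewrite -/r; lra.
  - by apply: contra nc; exact: completed_mono ttau.
  - by apply: pred_done; lra.
have waitQ t : t0 <= t -> t <= tau -> ~~ running (sched t) (i, j) ->
    rem js sched (i, j) t <= mu * (tau - t).
  move=> t0t ttau nr; have wt : waiting js sched t (sched t) (i, j).
    by rewrite /waiting en.
  have dt : deadline js (i, j) <= t by rewrite dE; lra.
  apply: le_trans (rem_waiting_le wt dt) _; rewrite dE.
  have := Gbound_le pf ts i; rewrite -/p -/e.
  have : Rs * (x + Num.max 0 (p - e)) <= Rs * (x + (p - em)).
    rewrite ler_pM2l ?(lt_le_trans ltr01) // lerD2l ge_max; apply/andP; split; lra.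
  have : 0 <= (Rs - mu) * (t - t0) by rewrite mulr_ge0 // subr_ge0.
  by rewrite t0E /tau; lra.
suff : rem js sched (i, j) tau <= mu * (tau - tau).
  rewrite subrr mulr0 remE subr_le0 => h; case/negP: nc; exact: h.
apply: (@real_induction _ t0 tau (fun t => rem js sched (i, j) t <= mu * (tau - t))) => //.
- have := rem_le_cost Hs (i, j) t0; rewrite /= -/e /t0; lra.
- move=> t /andP[t0t ttau] Qt; have [eps eps0 te] := right_constant Hs t.
  have [run|nrun] := boolP (running (sched t) (i, j)).
    exists eps => // s /andP[lts se].
    have := @serv_step _ _ _ _ _ _ _ Hs (i, j) t s (sched t) (ltW lts).
    have tes v : t < v < s -> sched v = sched t.
      by move=> /andP[tv vs]; apply: te; rewrite (ltW tv) (lt_trans vs).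
    move=> /(_ tes); have : mu * (s - t) <= arate (sched t) (i, j) * (s - t).
      rewrite ler_wpM2r // ?subr_ge0 ?(ltW lts) //.
      case/existsP: run => q qE; rewrite /arate (bigD1 q) //= ler_wpDr //.
        by apply: sumr_ge0 => q' _; exact: speed_ge0.
      by rewrite ge_max speed_ge1; move/eqP/(sched_fast_enough Hs): qE.
    by move: Qt; rewrite !remE; lra.
  exists (Num.min eps (tau - t)); first by rewrite lt_min eps0 subr_gt0.
  move=> s; rewrite -ltrBlDl lt_min => /and3P[lts se stau].
  apply: waitQ; [lra | lra |].
  by rewrite te // (ltW lts) /=; lra.
- move=> t /andP[t0t ttau] IH.
  apply: (@le_of_lt_add_eps _ _ _ mu (ltW mu0)) => eta eta0.
  pose s := Num.max t0 (t - eta).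
  have t0s : t0 <= s by rewrite le_max lexx.
  have st : s < t by rewrite gt_max t0t /=; lra.
  have ts' : t - eta <= s by rewrite le_max lexx orbT.
  have := IH s; rewrite t0s st => /(_ isT).
  have := serv_mono Hs (i, j) (ltW st).
  have : mu * (t - eta) <= mu * s by rewrite ler_pM2l.
  by rewrite !remE; lra.
Qed.

(** The predecessor was released at least a period earlier, so its own bound ends by
    [release js i j + x + period ts i]. *)
Lemma completed_by i j :
  completed js sched (i, j) (release js i j + (x + 2 * period ts i)).
Proof.
elim: j => [|j IH]; apply: completed_by_of_pred => // t rt.
apply: (completed_mono Hs) IH; have := release_sep js i j; lra.
Qed.

Lemma response_time_le i :
  (response_time js sched i <= (x + 2 * period ts i)%:E)%E.
Proof.
apply: ge_ereal_sup => _ [j _ <-]; rewrite /job_response_time ge_max.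
have p0 := period_gt0 ts i; have x0 := xbound_ge0 pf ts.
apply/andP; split; first by rewrite lee_fin addr_ge0 ?mulr_ge0 ?(ltW p0).
rewrite leeBlDr // -EFinD addrC; apply: ereal_inf_lbound.
by exists (release js i j + (x + 2 * period ts i)) => //; exact: completed_by.
Qed.

End ResponseTime.

Theorem theorem2 (R : realType) (z n : nat)
    (pf : platform R z) (ts : task_system R n)
    (Hutil : forall i : 'I_n.+1, util ts i <= alpha pf ord_max)
    (HPhiPsi : forall k : 'I_z.+1, (k < z)%N -> (#|Phi pf ts k| <= #|Psi pf k|)%N)
    (HU : Usum ts <= Rsum pf)
    (js : job_sequence ts) (sched : schedule n pf)
    (Hsched : np_gedf_h js sched) (i : 'I_n.+1) :
  (response_time js sched i <= (xbound pf ts + 2 * period ts i)%:E)%E.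
Proof. exact: response_time_le Hsched Hutil HPhiPsi HU i. Qed.
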